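(* Let $X$ be a Polish space, let $E$ be a countable Borel equivalence relation on $X$, and let $\mu$ be an $E$-invariant Borel probability measure on $X$. Suppose that there is a free Borel action of a countable non-abelian free group on $X$ whose orbit equivalence relation is a subequivalence relation of $E$. Then for every countable non-abelian free group $\Gamma$, there is a Borel $\mu$-stratification of $E$ by free actions of $\Gamma$ on $X$.
   Context: An equivalence relation is countable if all its classes are countable. For $B\subseteq X$, $E\upharpoonright B=E\cap(B\times B)$ and $\mu\upharpoonright B$ is the restriction of $\mu$ to $B$. The orbit equivalence relation generated by an action of $\Gamma$ on $X$ relates $x$ and $y$ iff $\gamma\cdot x=y$ for some $\gamma\in\Gamma$. An action is free if $\gamma\cdot x=x$ only for $\gamma=\mathrm{id}$. A Borel probability measure $\mu$ on $X$ is $E$-invariant if $\mu(B)=\mu(T(B))$ for every Borel $B\subseteq X$ and every Borel automorphism $T\colon X\to X$ whose graph is contained in $E$. A sequence $(E_r)_{r\in\mathbb{R}}$ of subequivalence relations of $E$ is a stratification of $E$ if for all reals $r<s$ every $E_r$-class is properly contained in an $E_s$-class. It is a $\mu$-stratification of $E$ if it is a stratification and moreover, for all $\mu$-positive Borel sets $B\subseteq X$ and all reals $r<s$, the $(E_r\upharpoonright B)$-class of $(\mu\upharpoonright B)$-almost every point of $B$ is properly contained in an $(E_s\upharpoonright B)$-class. A sequence $(\cdot_r)_{r\in\mathbb{R}}$ of actions of $\Gamma$ on $X$ is a ($\mu$-)stratification of $E$ if the corresponding sequence of orbit equivalence relations is a ($\mu$-)stratification of $E$; it is Borel if $\{(r,((\gamma,x),y))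 : \gamma\cdot_r x=y\}$ is a Borel subset of $\mathbb{R}\times((\Gamma\times X)\times X)$. *)

(* Defs.v *)
From mathcomp Require Import all_boot all_order all_algebra.
From mathcomp Require Import all_classical all_reals all_analysis.
Set Implicit Arguments.
Unset Strict Implicit.
Unset Printing Implicit Defensive.
Import Order.TTheory GRing.Theory Num.Theory.
Import numFieldTopology.Exports numFieldNormedType.Exports.
Local Open Scope classical_set_scope.
Local Open Scope ring_scope.

Definition polish (R : realType) (X : topologicalType) : Prop :=
  (exists2 D : set X, countable D & dense D) /\
  exists d : X -> X -> R,
    [/\ forall x y, d x y = 0 <-> x = y,
        forall x y, d x y = d y x,
        forall x y z, d x z <= d x y + d y z,
        forall (x : X) (A : set X),
          nbhs x A <-> exists2 e : R, 0 < e & [set y | d x y < e] `<=` A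
      & forall u : nat -> X,
          (forall e : R, 0 < e -> exists N : nat, forall m n : nat,
             (N <= m)%N -> (N <= n)%N -> d (u m) (u n) < e) ->
          exists l : X, u @ \oo --> l].

Definition Borel (T : topologicalType) : set (set T) := <<s @open T >>.

Definition borel_fun (T U : topologicalType) (f : T -> U) : Prop :=
  forall B : set U, Borel B -> Borel (f @^-1` B).

(* X with its Borel sets as measurable sets: [measurable B] and [Borel B] are
   convertible. *)
Definition borelType (X : ptopologicalType) := g_sigma_algebraType (@open X).

Section Relations.
Variable X : Type.
Implicit Types (E : X -> X -> Prop) (B : set X).

Definition eqv_class E (x : X) : set X := [set y | E x y].

(* The intersection of E with B * B. *)
Definition restr E B : X -> X -> Prop := fun x y => [/\ E x y, B x & B y].

Definition subrelation E E' : Prop := forall x y, E x y -> E' x y.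

End Relations.

Definition countable_borel_equivalence (X : topologicalType)
    (E : X -> X -> Prop) : Prop :=
  [/\ RelationClasses.Equivalence E,
      forall x, countable (eqv_class E x)
    & Borel [set p : X * X | E p.1 p.2]].

Definition borel_automorphism (X : topologicalType) (T : X -> X) : Prop :=
  exists T' : X -> X,
    [/\ cancel T T', cancel T' T, borel_fun T & borel_fun T'].

Definition invariant_measure (R : realType) (X : ptopologicalType)
    (E : X -> X -> Prop) (mu : probability (borelType X) R) : Prop :=
  forall T : X -> X, borel_automorphism T -> (forall x, E x (T x)) ->
  forall B : set X, Borel B -> mu B = mu (T @` B).

Section FreeGroups.
Variable G : groupType.
Local Open Scope group_scope.

(* The letter (s, false) stands for s and (s, true) for its inverse. *)
Definition letter (l : G * bool) : G := if l.2 then l.1^-1 else l.1.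

Definition word_value (w : seq (G * bool)) : G :=
  foldr (fun l g => letter l * g) 1 w.

Definition reduced (w : seq (G * bool)) : bool :=
  sorted (fun l m => ~~ ((l.1 == m.1) && (l.2 != m.2))) w.

Definition free_basis (S : set G) : Prop :=
  forall g : G, exists! w : seq (G * bool),
    [/\ forall l, l \in w -> S l.1, reduced w & word_value w = g].

Definition free_group : Prop := exists S : set G, free_basis S.

Definition countable_nonabelian_free_group : Prop :=
  [/\ countable [set: G], ~ (forall g h : G, commute g h) & free_group].

End FreeGroups.

Section Actions.
Variables (G : groupType) (X : Type).
Implicit Type a : G -> X -> X.

Definition group_action a : Prop :=
  (forall x, a 1%g x = x) /\ (forall g h x, a (g * h)%g x = a g (a h x)).

Definition free_action a : Prop := forall g x, a g x = x -> g = 1%g.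

Definition orbit_rel a : X -> X -> Prop := fun x y => exists g, a g x = y.

End Actions.

(* Countable groups carry the discrete topology. *)
Definition borel_action (G : groupType) (X : topologicalType)
    (a : G -> X -> X) : Prop :=
  borel_fun (fun p : discrete_topology G * X => a p.1 p.2).

Definition borel_family (R : realType) (G : groupType) (X : topologicalType)
    (a : R -> G -> X -> X) : Prop :=
  Borel [set p : R * ((discrete_topology G * X) * X) |
         a p.1 p.2.1.1 p.2.1.2 = p.2.2].

Definition stratification (R : realType) (X : Type) (E : X -> X -> Prop)
    (F : R -> X -> X -> Prop) : Prop :=
  [/\ forall r, RelationClasses.Equivalence (F r),
      forall r, subrelation (F r) E
    & forall r s, r < s ->
        forall x, exists y, eqv_class (F r) x `<` eqv_class (F s) y].

Definition mu_stratification (R : realType) (X : ptopologicalType)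
    (mu : probability (borelType X) R) (E : X -> X -> Prop)
    (F : R -> X -> X -> Prop) : Prop :=
  stratification E F /\
  forall (B : set (borelType X)) (mB : measurable B), (0 < mu B)%E ->
  forall r s, r < s ->
    {ae mrestr mu mB, forall x, B x ->
      exists2 y, B y & eqv_class (restr (F r) B) x `<` eqv_class (restr (F s) B) y}.

(* Main.v *)
Require Import Defs.
From HB Require Import structures.
From mathcomp Require Import all_boot all_order all_algebra.
From mathcomp Require Import all_classical all_reals all_analysis.
From mathcomp Require Import zify lra.

(** Let a free group D of rank at least two act freely on X inside E, and let s
  and t be two elements of a basis of D.

  The group G has to act freely for every real r, with orbits that grow with
  r. The orbits cannot grow by adding generators when G has finite rank n,
  because a free measure-preserving action of G generates a relation of cost
  n. They can grow inside the orbits of one generator, where the relation is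
  hyperfinite. So a single basis element e0 of G carries all of the growth: in
  the r-th action e0 acts by a free Borel Z-action T_r inside the orbits of t,
  and every other basis element e acts, whatever r is, as the conjugate s^i t
  s^-i for an exponent i = iota e > 0 of its own. Since e0 moves a point by a
  nonzero power of t, which is the case i = 0, a reduced product of powers of
  basis elements of G moves each point by a product of s^i t^k s^-i with
  consecutive i distinct and k nonzero. Such a product is not 1 in D
  ([conj_value_neq1]), so the actions are free, and it is a power of t only if
  it has at most one factor, with i = 0 ([conj_value_power]); hence two points
  of one t-orbit are in the same orbit of the r-th action only if they are in
  the same orbit of T_r.

  There remains to find an increasing family of free Z-actions T_r in a free
  Borel Z-action U. The orbits of U contain a Borel equivalence relation sim
  that carries a labelling by binary sequences which maps every sim-class
  bijectively onto a class of eventual equality ([digit_labelling_ex]). It is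
  obtained by halving: X is split by a Borel matching of points in the same
  U-orbit, the left half is split in the same way, and so on; the n-th digit
  says on which side of the n-th splitting the point lies. A greedy Borel
  matching leaves at most one point of each orbit unmatched, and on the orbits
  where this happens at some stage the first leftover point is a base point,
  from which the digits can be prescribed outright.

  Let C_r be the set of coordinates labelled with a rational number below r.
  The relation of being sim-related with labels that differ only on C_r is
  generated by a free Z-action T_r: the odometer on the coordinates in C_r,
  which adds one with carry. On the classes of sequences that are eventually
  constant on C_r the odometer does not produce a copy of Z, but these classes
  are in canonical bijection with the natural numbers, hence with Z. Both
  cases are covered by an integer-valued cocycle [offset] on eventually equal
  sequences for which all values are taken exactly once.

  For r < s there are infinitely many coordinates in C_s outside C_r. The
  involutions h_j that flip the j-th of these digits satisfy: if i and j
  differ, then h_j (h_i x) is in the s-orbit of x but not in its r-orbit. This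
  gives strict growth everywhere. If it failed on a Borel set B at the points
  of N, then no point h_j (h_i x) with x in N and i, j distinct would lie in
  B, so the sets h_j N would be pairwise disjoint; as they have the same
  measure, N is null ([mu_stratification_gaps]). *)

Set Implicit Arguments.
Unset Strict Implicit.
Unset Printing Implicit Defensive.
Import Order.TTheory GRing.Theory Num.Theory.
Import numFieldTopology.Exports numFieldNormedType.Exports.
Local Open Scope classical_set_scope.
Local Open Scope ring_scope.

(** * Free groups *)

Section IntegerPowers.
Variable G : groupType.
Local Open Scope group_scope.

Definition zexp (g : G) (k : int) : G :=
  match k with Posz n => g ^+ n | Negz n => g ^- n.+1 end.

Lemma zexpS g k : zexp g (k + 1)%R = zexp g k * g.
Proof.
case: k => [n|[|n]].
- by rewrite -PoszD addn1 /= expgSr.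
- by rewrite /= expg1 mulVg.
have -> : (Negz n.+1 + 1)%R = Negz n by rewrite !NegzE; lia.
by rewrite /= (expgS _ n.+1) invgM mulgVK.
Qed.

Lemma zexpD g j k : zexp g (j + k)%R = zexp g j * zexp g k.
Proof.
have zexpB i : zexp g (i - 1)%R = zexp g i * g^-1.
  by apply: (mulIg g); rewrite -zexpS subrK mulgVK.
elim/int_rec: k => [|n IH|n IH].
- by rewrite addr0 mulg1.
- by rewrite intS addrCA addrC !(addrC 1%R) !zexpS IH mulgA.
- by rewrite intS opprD addrCA addrC !(addrC (- 1)%R) !zexpB IH mulgA.
Qed.

Lemma zexpN g k : zexp g (- k)%R = (zexp g k)^-1.
Proof. by apply: (mulIg (zexp g k)); rewrite -zexpD addNr mulVg. Qed.

End IntegerPowers.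

Section Words.
Variable G : groupType.
Local Open Scope group_scope.

Definition word_in (S : set G) (w : seq (G * bool)) : Prop :=
  forall l, l \in w -> S l.1.

Definition word_act (Y : Type) (phi phi' : G -> Y -> Y) (w : seq (G * bool)) :
    Y -> Y :=
  fun y => foldr (fun l z => if l.2 then phi' l.1 z else phi l.1 z) y w.

Definition cons_reduced (l : G * bool) (w : seq (G * bool)) :=
  if w is m :: w' then
    if (l.1 == m.1) && (l.2 != m.2) then w' else l :: w
  else [:: l].

Lemma reduced_cons_reduced l w : reduced w -> reduced (cons_reduced l w).
Proof.
case: w => //= m w red_mw; case: ifP => [_|cancelF].
  exact: path_sorted red_mw.
by rewrite /reduced /= cancelF.
Qed.

Lemma word_in_cons_reduced S l w :
  S l.1 -> word_in S w -> word_in S (cons_reduced l w).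
Proof.
move=> Sl; case: w => /= [_ m|m w Sw]; first by rewrite inE => /eqP ->.
case: ifP => _ n nw; first by apply: Sw; rewrite inE nw orbT.
by move: nw; rewrite inE => /orP[/eqP -> //|/Sw].
Qed.

Lemma word_value_cons_reduced l w :
  word_value (cons_reduced l w) = letter l * word_value w.
Proof.
case: w => //= m w; case: ifP => // /andP[/eqP].
case: l m => [e [|]] [f [|]] //= <- _; rewrite /letter /= mulgA.
- by rewrite mulVg mul1g.
- by rewrite mulgV mul1g.
Qed.

Lemma word_act_cons_reduced Y (phi phi' : G -> Y -> Y) l w :
    (forall e, cancel (phi e) (phi' e)) -> (forall e, cancel (phi' e) (phi e)) ->
  word_act phi phi' (cons_reduced l w) =1 word_act phi phi' (l :: w).
Proof.
move=> phiK phi'K y; case: w => //= m w; case: ifP => // /andP[/eqP].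
by case: l m => [e [|]] [f [|]] //= <- _; rewrite ?phiK ?phi'K.
Qed.

(** Cancelling letters changes neither the value of a word nor its effect in
  any interpretation of the letters by bijections. *)
Lemma free_basis_reduce S Y (phi phi' : G -> Y -> Y) w :
    (forall e, cancel (phi e) (phi' e)) -> (forall e, cancel (phi' e) (phi e)) ->
    word_in S w ->
  exists w', [/\ word_in S w', reduced w', word_value w' = word_value w &
    word_act phi phi' w' =1 word_act phi phi' w].
Proof.
move=> phiK phi'K; elim: w => [|l w IH] Sw; first by exists [::].
have [|w' [Sw' redw' valw' actw']] := IH.
  by move=> m mw; apply: Sw; rewrite inE mw orbT.
exists (cons_reduced l w'); split.
- by apply: word_in_cons_reduced => //; apply: Sw; rewrite mem_head.
- exact: reduced_cons_reduced.
- by rewrite word_value_cons_reduced valw'.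
- by move=> y; rewrite word_act_cons_reduced //= actw'.
Qed.

Lemma word_value_cat v w : word_value (v ++ w) = word_value v * word_value w :> G.
Proof. by elim: v => [|l v IH] /=; rewrite ?mul1g // IH mulgA. Qed.

(** The universal property: arbitrary bijections may be assigned to the basis
  elements.  The action is defined on reduced words and is multiplicative
  because reduction does not change the effect of a word. *)
Lemma free_basis_extension S Y (phi phi' : G -> Y -> Y) :
    free_basis S ->
    (forall e, cancel (phi e) (phi' e)) -> (forall e, cancel (phi' e) (phi e)) ->
  exists A : G -> Y -> Y, group_action A /\
    forall w, word_in S w -> A (word_value w) =1 word_act phi phi' w.
Proof.
move=> freeS phiK phi'K.
have /boolp.choice[nf nfP] : forall g, exists w,
    [/\ word_in S w, reduced w & word_value w = g].
  by move=> g; have [w [wP _]] := freeS g; exists w.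
pose A g := word_act phi phi' (nf g).
have AE w : word_in S w -> A (word_value w) =1 word_act phi phi' w.
  move=> Sw y.
  have [w' [Sw' redw' valw' actw']] := free_basis_reduce phiK phi'K Sw.
  rewrite -actw' /A; congr (word_act _ _ _ y).
  have [v [_ uniq_v]] := freeS (word_value w).
  by rewrite -(uniq_v _ (nfP _)); apply: uniq_v.
exists A; split=> //; split=> [y|g h y].
  by rewrite -[1]/(word_value [::]) AE.
have [Sg _ <-] := nfP g; have [Sh _ <-] := nfP h.
rewrite -word_value_cat !AE //; first by rewrite /word_act foldr_cat.
by move=> l; rewrite mem_cat => /orP[/Sg|/Sh].
Qed.

Definition syl_value (L : seq (G * int)) : G :=
  foldr (fun a g => zexp a.1 a.2 * g) 1 L.

(** The normal forms of products of powers. *)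
Definition alternating (I : eqType) (L : seq (I * int)) : bool :=
  sorted (fun a b => a.1 != b.1) L && all (fun a => a.2 != 0%R) L.

Lemma alternating_cons (I : eqType) (a : I * int) L :
  alternating (a :: L) =
  [&& a.2 != 0%R, (if L is b :: _ then a.1 != b.1 else true) & alternating L].
Proof.
rewrite /alternating /=; case: L => [|b L] /=; first by rewrite !andbT.
case: (a.1 != b.1); case: (path _ _ _); case: (a.2 != _) => //=;
by rewrite ?andbF.
Qed.

Lemma letterE (l : G * bool) : letter l = zexp l.1 (if l.2 then -1 else 1)%R.
Proof. by case: l => e [|]. Qed.

Lemma free_basis_syllables S g : free_basis S ->
  exists L, [/\ alternating L, forall a, a \in L -> S a.1 & syl_value L = g].
Proof.
move=> /(_ g)[w [[Sw _ <-] _]].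
elim: w Sw => [|l w IH] Sw; first by exists [::].
have Sl : S l.1 by apply: Sw; rewrite mem_head.
have [|L [altL SL valL]] := IH.
  by move=> m mw; apply: Sw; rewrite inE mw orbT.
rewrite /= letterE -valL.
set eps : int := if l.2 then _ else _.
have eps0 : eps != 0%R by rewrite /eps; case: l.2.
have [L0|] := boolP (if L is b :: _ then l.1 != b.1 else true).
  exists ((l.1, eps) :: L); split => //; first by rewrite alternating_cons eps0 L0.
  by move=> a; rewrite inE => /orP[/eqP -> //|/SL].
case: L altL SL {valL} => // -[e k] L altL SL; rewrite negbK => /= /eqP le.
move: altL; rewrite alternating_cons => /= /and3P[k0 eL altL].
rewrite mulgA le -zexpD.
have [ek0|ek0] := eqVneq (eps + k)%R 0%R.
  exists L; split => //; last by rewrite ek0 mul1g.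
  by move=> a aL; apply: SL; rewrite inE aL orbT.
exists ((e, eps + k)%R :: L); split => //.
  by rewrite alternating_cons /= ek0 eL.
move=> a; rewrite inE => /orP[/eqP -> /=|aL]; first by rewrite -le.
by apply: SL; rewrite inE aL orbT.
Qed.

Definition syl_word (L : seq (G * int)) : seq (G * bool) :=
  flatten [seq nseq `|a.2|%N (a.1, (a.2 < 0)%R) | a <- L].

Lemma word_value_nseq n (l : G * bool) : word_value (nseq n l) = letter l ^+ n.
Proof. by elim: n => //= n ->; rewrite expgS. Qed.

Lemma syl_wordP L : word_value (syl_word L) = syl_value L.
Proof.
elim: L => //= -[e k] L IH.
rewrite /syl_word /= word_value_cat word_value_nseq -/(syl_word L) IH.
by congr (_ * _); case: k => n //=; rewrite /letter /= expVgn.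
Qed.

(** The word obtained by writing out the powers is reduced and nonempty, so it
  differs from the empty word, the only reduced word of value 1. *)
Lemma syl_value_neq1 S L : free_basis S -> alternating L ->
  (forall a, a \in L -> S a.1) -> L != [::] -> syl_value L <> 1.
Proof.
move=> freeS altL SL L0 L1.
have SwL : word_in S (syl_word L).
  move=> l /flattenP[w /mapP[a aL ->]]; rewrite mem_nseq => /andP[_ /eqP ->].
  exact: SL.
have [headL redL] : (if syl_word L is l :: _ then
    if L is a :: _ then l.1 == a.1 else false else L == [::]) /\
    reduced (syl_word L).
  elim: L altL {SL L0 L1 SwL} => // -[e k] L IH.
  rewrite alternating_cons => /= /and3P[k0 eL /IH[headL redL]].
  rewrite /syl_word /= -/(syl_word L).
  have : (0 < `|k|)%N by rewrite absz_gt0.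
  case: `|k|%N => // n _; rewrite /= eqxx; split=> //.
  rewrite /reduced /=; elim: n => [|n IHn] /=; last by rewrite eqxx eqxx.
  move: headL redL eL; case: (syl_word L) => // m w.
  by case: L {IH} => // a L /eqP <- redm /negPf em; rewrite /= em.
have [v [_ uniq_v]] := freeS 1.
have vL : v = syl_word L by apply: uniq_v; rewrite syl_wordP.
have v0 : v = [::] by apply: uniq_v; split.
by move: headL L0; rewrite -vL v0 => ->.
Qed.

End Words.

Section ConjugatesOfABasisElement.
Variables (G : groupType) (S : set G) (s t : G).
Local Open Scope group_scope.
Hypotheses (freeS : free_basis S) (Ss : S s) (St : S t) (neq_st : s != t).

Definition conj_power (i : nat) (k : int) : G :=
  zexp s i * zexp t k * zexp s (- i%:Z)%R.

Definition conj_value (L : seq (nat * int)) : G :=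
  foldr (fun a g => conj_power a.1 a.2 * g) 1 L.

(** Neighbouring powers of s merge into s^(j - i), with j - i nonzero, so
  that the product becomes alternating in s and t; only the leading power of s
  may be trivial. *)
Lemma conj_value_syllables i k L : alternating ((i, k) :: L) ->
  exists A, [/\ alternating A, forall a, a \in A -> S a.1,
    (if A is a :: _ then a.1 == t else false) &
    conj_value ((i, k) :: L) = zexp s i * syl_value A].
Proof.
elim: L i k => [|[j l] L IH] i k; rewrite alternating_cons => /= /and3P[k0].
  move=> _ _; have [->|i0] := eqVneq i 0%N.
    exists [:: (t, k)]; rewrite /alternating /= k0 eqxx; split => //.
      by move=> a; rewrite inE => /eqP ->.
    by rewrite /conj_power !mulg1.
  exists [:: (t, k); (s, - i%:Z)%R]; rewrite /alternating /= k0 eqxx eq_sym neq_st.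
  split=> //; last by rewrite /conj_power !mulg1 mulgA.
    by rewrite oppr_eq0 /= andbT; move: i0; lia.
  by move=> a; rewrite !inE => /orP[] /eqP ->.
move=> ij /IH[A [altA SA headA /= ->]].
exists [:: (t, k), (s, (j%:Z - i%:Z)%R) & A]; split => /=; last 2 first.
- by rewrite eqxx.
- by rewrite (addrC j%:Z) zexpD /conj_power -!mulgA.
- rewrite !alternating_cons /= k0 eq_sym neq_st altA subr_eq0 andbT /=.
  by rewrite eqz_nat eq_sym ij /=; case: A headA {altA SA} => // a A /eqP ->.
- by move=> a; rewrite !inE => /orP[/eqP -> //|/orP[/eqP -> //|/SA]].
Qed.

(** The elements s^i t s^-i freely generate a free group. *)
Lemma conj_value_neq1 L : alternating L -> L != [::] -> conj_value L <> 1.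
Proof.
case: L => // -[i k] L /conj_value_syllables[A [altA SA headA ->]] _.
have [->|i0] := eqVneq i 0%N.
  rewrite mul1g; apply: (syl_value_neq1 freeS) => //; by case: (A) headA.
have -> : zexp s i * syl_value A = syl_value ((s, i%:Z) :: A) by [].
apply: (syl_value_neq1 freeS) => //; last first.
  by move=> a; rewrite inE => /orP[/eqP -> //|/SA].
rewrite alternating_cons altA andbT /=; apply/andP; split; first by lia.
by case: (A) headA => // a B /eqP ->.
Qed.

(** Left multiplication by t^-m gives a product of value 1.  The new factor, of
  index 0, merges with a first factor of index 0 of the list if there is one;
  what remains after cancellation must be empty by [conj_value_neq1]. *)
Lemma conj_value_power L m : alternating L -> conj_value L = zexp t m ->
  L = [::] \/ exists k, L = [:: (0%N, k)].
Proof.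
move=> altL valL; case: L altL valL => [|[i k] L]; first by left.
move=> altL valL; right.
have tE j : zexp t j = conj_power 0 j by rewrite /conj_power mulg1 mul1g.
have [m0|m0] := eqVneq m 0%R.
  by case: (@conj_value_neq1 ((i, k) :: L)) => //; rewrite valL m0.
have key L' : conj_value ((0%N, - m)%R :: L') = (zexp t m)^-1 * conj_value L'.
  by rewrite /= -tE zexpN.
have [i0|i0] := eqVneq i 0%N; last first.
  case: (@conj_value_neq1 ((0%N, - m)%R :: (i, k) :: L)) => //.
    by rewrite alternating_cons /= oppr_eq0 m0 eq_sym i0.
  by rewrite key valL mulVg.
move: altL valL; rewrite i0 alternating_cons => /= /and3P[k0 headL altL].
rewrite -tE => valL.
have [mk|mk] := eqVneq k m.
  have L1 : conj_value L = 1.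
    by apply: (mulgI (zexp t k)); rewrite mulg1 valL mk.
  exists k; case: (eqVneq L [::]) => [-> //|/(conj_value_neq1 altL)].
  by rewrite L1.
case: (@conj_value_neq1 ((0%N, - m + k)%R :: L)) => //.
  by rewrite alternating_cons /= headL altL andbT; lia.
by rewrite /= -tE zexpD -mulgA valL zexpN mulVg.
Qed.

End ConjugatesOfABasisElement.

(** * Measurable predicates *)

Section MeasurablePredicates.
Context {d : measure_display} {T : measurableType d}.
Implicit Types P Q : T -> Prop.

Definition mpred P := measurable [set x | P x].

Lemma eq_mpred P Q : (forall x, P x <-> Q x) -> mpred P -> mpred Q.
Proof.
by move=> PQ; rewrite /mpred (_ : [set x | P x] = [set x | Q x]) // predeqE.
Qed.

Lemma mpred_const (P : Prop) : mpred (fun=> P).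
Proof.
have [p|np] := pselect P.
  by apply: (@eq_mpred (fun=> True)) => //; exact: measurableT.
by apply: (@eq_mpred (fun=> False)) => //; exact: measurable0.
Qed.

Lemma mpred_not P : mpred P -> mpred (fun x => ~ P x).
Proof. exact: measurableC. Qed.

Lemma mpred_and P Q : mpred P -> mpred Q -> mpred (fun x => P x /\ Q x).
Proof. exact: measurableI. Qed.

Lemma mpred_or P Q : mpred P -> mpred Q -> mpred (fun x => P x \/ Q x).
Proof. exact: measurableU. Qed.

Lemma mpred_imp P Q : mpred P -> mpred Q -> mpred (fun x => P x -> Q x).
Proof.
move=> mP mQ; apply: (@eq_mpred (fun x => ~ P x \/ Q x)).
  by move=> x; split=> [[]//|PQ]; case: (pselect (P x)); [right; apply: PQ|left].
exact/mpred_or/mQ/mpred_not.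
Qed.

(** The index type is arbitrary because quantification over a countable group
  is needed, and such a group has no preferred enumeration. *)
Lemma mpred_ex (I : Type) (P : I -> T -> Prop) : countable [set: I] ->
  (forall i, mpred (P i)) -> mpred (fun x => exists i, P i x).
Proof.
move=> /countable_injP[c /in2TT c_inj] mP.
apply: (@eq_mpred (fun x => exists n : nat, exists i, c i = n /\ P i x)).
  by move=> x; split=> [[n [i [_ ?]]]|[i ?]]; [exists i|exists (c i), i].
rewrite /mpred (_ : [set x | _] = \bigcup_n [set x | exists i, c i = n /\ P i x]);
  last by apply/seteqP; split=> x [n]; [exists n|move=> _; exists n].
apply: bigcupT_measurable => n.
have [[i ci]|noi] := pselect (exists i, c i = n); last first.
  apply: (@eq_mpred (fun=> False)); last exact: mpred_const.
  by move=> x; split=> // -[i [ci _]]; apply: noi; exists i.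
apply: eq_mpred (mP i) => x; split=> [|[j [cj]]]; first by exists i.
by rewrite -(c_inj i j) // ci cj.
Qed.

Lemma mpred_all (I : Type) (P : I -> T -> Prop) : countable [set: I] ->
  (forall i, mpred (P i)) -> mpred (fun x => forall i, P i x).
Proof.
move=> cI mP; apply: (@eq_mpred (fun x => ~ exists i, ~ P i x)).
  by move=> x; rewrite -forallNE; split=> H i; [apply: contrapT; apply: H|].
by apply/mpred_not/mpred_ex => // i; apply: mpred_not.
Qed.

(** Measurability for the discrete sigma-algebra on the target. *)
Definition discrete_valued (I : Type) (f : T -> I) :=
  forall A : set I, mpred (fun x => A (f x)).

Lemma discrete_valued_fibers (I : Type) (f : T -> I) : countable [set: I] ->
  (forall i, mpred (fun x => f x = i)) -> discrete_valued f.
Proof.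
move=> cI mf A.
apply: (@eq_mpred (fun x => exists i, f x = i /\ A i)).
  by move=> x; split=> [[i [->]]|Af] //; exists (f x).
by apply: mpred_ex => // i; apply: mpred_and => //; apply: mpred_const.
Qed.

Lemma mpred_discrete (I : Type) (f : T -> I) (P : I -> T -> Prop) :
  countable [set: I] -> discrete_valued f ->
  (forall i, mpred (P i)) -> mpred (fun x => P (f x) x).
Proof.
move=> cI mf mP; apply: (@eq_mpred (fun x => exists i, f x = i /\ P i x)).
  by move=> x; split=> [[i [->]]|Af] //; exists (f x).
by apply: mpred_ex => // i; apply: mpred_and => //; apply: (mf [set i]).
Qed.

Lemma discrete_valued2 (I J K : Type) (op : I -> J -> K) (f : T -> I) (g : T -> J) :
  countable [set: I] -> discrete_valued f -> discrete_valued g ->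
  discrete_valued (fun x => op (f x) (g x)).
Proof.
move=> cI mf mg A; apply: (mpred_discrete (P := fun i x => A (op i (g x)))) => //.
by move=> i; apply: (mg [set j | A (op i j)]).
Qed.

Lemma discrete_valued_comp (I J : Type) (op : I -> J) (f : T -> I) :
  discrete_valued f -> discrete_valued (fun x => op (f x)).
Proof. by move=> mf A; apply: (mf [set i | A (op i)]). Qed.

Lemma discrete_valued_asbool P : mpred P -> discrete_valued (fun x => `[<P x>]).
Proof.
move=> mP A; apply: (@eq_mpred (fun x => (P x -> A true) /\ (~ P x -> A false))).
  move=> x; case: asboolP => Px; split=> [[At Af]|Ab]; first exact: At.
  - by split.
  - exact: Af.
  - by split.
by apply: mpred_and; apply: mpred_imp; try exact: mpred_const; last exact: mpred_not.
Qed.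

End MeasurablePredicates.

Lemma mpred_comp d d' (T : measurableType d) (T' : measurableType d')
    (f : T -> T') (P : T' -> Prop) :
  measurable_fun setT f -> mpred P -> mpred (fun x => P (f x)).
Proof. by move=> mf /(mf measurableT); rewrite setTI. Qed.

(** * The odometer cocycle on binary sequences *)

Section Odometer.
Variable C : nat -> bool.
Hypothesis C_infinite : forall N, exists2 n, (N <= n)%N & C n.
Local Open Scope nat_scope.
Implicit Types f g h : nat -> bool.

Definition flip_all f : nat -> bool := fun n => ~~ f n.

(** The coordinates in C are the digits of a binary numeral, least significant
  first; the weight of the coordinate M is 2 to the number of elements of C
  below M. *)
Fixpoint weight (M : nat) : nat :=
  if M is M'.+1 then (if C M' then 2 * weight M' else weight M') else 1.

Fixpoint numeral f (M : nat) : nat :=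
  if M is M'.+1 then numeral f M' + (if C M' && f M' then weight M' else 0)
  else 0.

Lemma numeral_lt f M : numeral f M < weight M.
Proof. by elim: M => //= M IH; case: (C M); case: (f M) => /=; lia. Qed.

Lemma numeral_flip_all f M : numeral f M + numeral (flip_all f) M + 1 = weight M.
Proof.
elim: M => //= M; rewrite [flip_all f M]/flip_all.
by case: (C M); case: (f M) => /=; lia.
Qed.

Lemma numeral_mono f M N : M <= N -> numeral f M <= numeral f N.
Proof.
move=> /subnK <-; elim: (N - M) => //= k IH; apply: leq_trans IH _.
exact: leq_addr.
Qed.

Lemma weight_unbounded a : exists M, a < weight M.
Proof.
elim: a => [|a [M aM]]; first by exists 0.
have [n Mn Cn] := C_infinite M; exists n.+1; rewrite /= Cn.
suff : weight M <= weight n by lia.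
rewrite -(subnK Mn); elim: (n - M) => //= k IH; case: (C _) => //; lia.
Qed.

Lemma weight_mono M N : M <= N -> weight M <= weight N.
Proof.
move=> /subnK <-; elim: (N - M) => //= k IH; case: (C _) => //; lia.
Qed.

Lemma numeral_inj f g M : numeral f M = numeral g M ->
  forall n, n < M -> C n -> f n = g n.
Proof.
elim: M => //= M IH; have := numeral_lt f M; have := numeral_lt g M.
move=> ltg ltf eqfg n; rewrite ltnS leq_eqVlt => /orP[/eqP ->|nM] Cn.
  by move: eqfg; rewrite Cn /=; case: (f M); case: (g M) => //; lia.
apply: IH => //; move: eqfg.
by case: (C M) => /=; case: (f M); case: (g M); lia.
Qed.

(** Induction on M: the digit at a new coordinate in C is decided by comparing
  a with the weight of that coordinate. *)
Lemma numeral_surj f M a : a < weight M -> exists g,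
  [/\ numeral g M = a, forall n, ~~ C n -> g n = f n &
      forall n, M <= n -> g n = f n].
Proof.
have ext g g' N : (forall n, n < N -> g n = g' n) -> numeral g N = numeral g' N.
  elim: N => //= N IH eqg; rewrite eqg // IH // => n nN; apply: eqg; lia.
elim: M a => [|M IH] a /=; first by exists f; split => //=; lia.
case CM: (C M) => /= ltaM; last first.
  have [g [ga gC gM]] := IH _ ltaM.
  exists g; split => //; first by rewrite addn0.
  by move=> n Mn; apply: gM; lia.
pose b := weight M <= a.
have [|g [ga gC gM]] := IH (if b then a - weight M else a).
  by rewrite /b; case: (leqP (weight M) a) => ?; lia.
exists (fun n => if n == M then b else g n); split=> [|n Cn|n Mn] /=.
- rewrite eqxx /= -(ext g) ?ga => [|n nM]; last by rewrite ltn_eqF.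
  by rewrite /b; case: (leqP (weight M) a) => ?; lia.
- by case: eqP => [nM|_]; [rewrite nM CM in Cn | apply: gC].
- by rewrite gtn_eqF //; apply: gM; lia.
Qed.

(** The numerals of f converge exactly when f vanishes eventually on C, and
  those of its complement exactly when f is eventually 1 on C. *)
Definition vanishing f := exists N, forall n, N <= n -> C n -> f n = false.

Lemma eq_tail_vanishing f g N : (forall n, N <= n -> f n = g n) ->
  vanishing f -> vanishing g.
Proof.
move=> fg [M fM]; exists (maxn M N) => n; rewrite geq_max => /andP[Mn Nn] Cn.
by rewrite -fg // fM.
Qed.

Lemma vanishing_numeral f : vanishing f ->
  exists N, forall n, N <= n -> numeral f n = numeral f N.
Proof.
case=> N fN; exists N => n /subnK <-; elim: (n - N) => //= k <-.
by case Ck: (C _); rewrite /= ?fN ?leq_addl // addn0.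
Qed.

Lemma nonvanishing_numeral f : ~ vanishing f ->
  forall a, exists M, a < numeral f M.
Proof.
move=> nvf; elim=> [|a [M aM]].
  have [n] : exists n, C n && f n.
    apply: contrapT => nof; apply: nvf; exists 0 => n _ Cn; apply/negbTE/negP => fn.
    by apply: nof; exists n; rewrite Cn.
  move=> Cfn; exists n.+1; rewrite /= Cfn.
  by have := weight_mono (leq0n n) => /=; lia.
have [n] : exists n, [&& M <= n, C n & f n].
  apply: contrapT => nof; apply: nvf; exists M => n Mn Cn; apply/negbTE/negP => fn.
  by apply: nof; exists n; rewrite Mn Cn.
case/and3P => Mn Cn fn; exists n.+1; rewrite /= Cn fn /=.
have := weight_mono (leq0n n) => /=; have := numeral_mono f Mn; lia.
Qed.

Lemma numeral_tail f g N : (forall n, N <= n -> f n = g n) -> forall n, N <= n ->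
  ((numeral f n)%:Z - (numeral g n)%:Z = (numeral f N)%:Z - (numeral g N)%:Z)%R.
Proof.
move=> fg n /subnK <-; elim: (n - N) => //= k <-.
by rewrite fg ?leq_addl //; lia.
Qed.

Definition zigzag (n : nat) : int := if odd n then Negz n./2 else Posz n./2.

Definition unzigzag (k : int) : nat :=
  match k with Posz n => n.*2 | Negz n => n.*2.+1 end.

Lemma unzigzagK : cancel unzigzag zigzag.
Proof.
by case=> n; rewrite /unzigzag /zigzag /= ?odd_double ?doubleK // uphalf_double.
Qed.

Lemma zigzagK : cancel zigzag unzigzag.
Proof.
by move=> n; rewrite /zigzag; case: ifP => on /=; have := odd_double_half n;
  rewrite on /=; lia.
Qed.

(** In general only differences of positions at large M matter.  In the
  exceptional classes the numerals converge to natural numbers, which zigzag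
  turns into integers so as to fill the negative half of Z as well. *)
Definition position f (M : nat) : int :=
  if `[<vanishing f>] then zigzag (numeral f M)
  else if `[<vanishing (flip_all f)>] then zigzag (numeral (flip_all f) M)
  else (numeral f M)%:Z.

(** A relation rather than a function, because the difference of positions is
  a limit that exists only for eventually equal sequences. *)
Definition offset f g (k : int) : Prop :=
  (forall n, ~~ C n -> f n = g n) /\
  exists N, forall n, N <= n -> f n = g n /\ (position f n - position g n)%R = k.

Lemma offset_refl f : offset f f 0.
Proof. by split => //; exists 0 => n _; rewrite subrr. Qed.

Lemma offset_sym f g k : offset f g k -> offset g f (- k)%R.
Proof.
move=> [Cfg [N fg]]; split=> [n /Cfg //|]; exists N => n /fg[-> <-].
by rewrite opprB.
Qed.

Lemma offset_trans f g h j k :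
  offset f g j -> offset g h k -> offset f h (j + k)%R.
Proof.
move=> [Cfg [N fg]] [Cgh [M gh]]; split=> [n Cn|]; first by rewrite Cfg // Cgh.
exists (maxn N M) => n; rewrite geq_max => /andP[/fg[-> <-] /gh[-> <-]].
by split => //; rewrite addrA subrK.
Qed.

Lemma offset_functional f g j k : offset f g j -> offset f g k -> j = k.
Proof.
move=> [_ [N fg]] [_ [M fg']].
have [_ <-] := fg (maxn N M) (leq_maxl _ _).
by have [_ <-] := fg' (maxn N M) (leq_maxr _ _).
Qed.

Lemma eq_tail_asbool f g N : (forall n, N <= n -> f n = g n) ->
  `[<vanishing f>] = `[<vanishing g>] /\
  `[<vanishing (flip_all f)>] = `[<vanishing (flip_all g)>].
Proof.
move=> fg; split; apply: asbool_equiv_eq; split; apply: (@eq_tail_vanishing _ _ N).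
- by [].
- by move=> n /fg.
- by move=> n /fg; rewrite /flip_all => ->.
- by move=> n /fg; rewrite /flip_all => ->.
Qed.

(** Eventually equal sequences are of the same kind, and in each kind the
  position determines the digits below M. *)
Lemma offset0_eq f g : offset f g 0 -> f = g.
Proof.
move=> [Cfg [N fg]]; apply/funext => n.
have [Cn|/Cfg //] := boolP (C n).
have [+ +] := @eq_tail_asbool f g N (fun n Nn => proj1 (fg n Nn)).
set M := maxn N n.+1; have nM : n < M by rewrite leq_max ltnSn orbT.
have [_] := fg M (leq_maxl _ _).
rewrite /position => fgM eqv eqv'; move: fgM; rewrite -eqv -eqv'.
case: asboolP => [vf|nvf].
  move/eqP; rewrite subr_eq0 => /eqP/(can_inj zigzagK)/numeral_inj; exact.
case: asboolP => [vf'|nvf'].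
  move/eqP; rewrite subr_eq0 => /eqP/(can_inj zigzagK)/numeral_inj.
  by move=> /(_ n nM Cn)/negb_inj.
by move/eqP; rewrite subr_eq0 => /eqP[]/numeral_inj; exact.
Qed.

Lemma offset_total f g N : (forall n, ~~ C n -> f n = g n) ->
  (forall n, N <= n -> f n = g n) -> exists k, offset f g k.
Proof.
move=> Cfg fg; suff [k [M Mk]] : exists k M, forall n, M <= n ->
    (position f n - position g n)%R = k.
  exists k; split => //; exists (maxn N M) => n; rewrite geq_max.
  by case/andP => /fg -> /Mk ->.
have fg' n : N <= n -> flip_all f n = flip_all g n by rewrite /flip_all => /fg ->.
rewrite /position; have [<- <-] := eq_tail_asbool fg.
case: asboolP => [vf|nvf].
  have [A fA] := vanishing_numeral vf.
  have [B gB] := vanishing_numeral (eq_tail_vanishing fg vf).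
  exists (zigzag (numeral f A) - zigzag (numeral g B))%R, (maxn A B) => n.
  by rewrite geq_max => /andP[/fA -> /gB ->].
case: asboolP => [vf|nvf'].
  have [A fA] := vanishing_numeral vf.
  have [B gB] := vanishing_numeral (eq_tail_vanishing fg' vf).
  exists (zigzag (numeral (flip_all f) A) - zigzag (numeral (flip_all g) B))%R.
  by exists (maxn A B) => n; rewrite geq_max => /andP[/fA -> /gB ->].
by exists ((numeral f N)%:Z - (numeral g N)%:Z)%R, N => n; apply: numeral_tail.
Qed.

Lemma vanishing_numeral_surj g a : vanishing g -> exists f,
  [/\ forall n, ~~ C n -> f n = g n,
      exists N, forall n, N <= n -> f n = g n &
      exists N, forall n, N <= n -> numeral f n = a].
Proof.
move=> vg; have [N gN] := vanishing_numeral vg; have [M aM] := weight_unbounded a.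
have [|f [fa fC ftail]] := @numeral_surj g (maxn M N) a.
  by apply: leq_trans aM _; apply/weight_mono/leq_maxl.
exists f; split=> //; first by exists (maxn M N).
exists (maxn M N) => n Mn; have := numeral_tail ftail Mn.
rewrite fa gN; last by move: Mn; rewrite geq_max => /andP[].
rewrite (gN (maxn M N)) ?leq_maxr //; lia.
Qed.

(** Outside the exceptional classes both the numerals of g and those of its
  complement are unbounded, so that for large M the number numeral g M + k lies
  between 0 and the weight of M and is a numeral. *)
Lemma offset_surj g k : exists f, offset f g k.
Proof.
have [vg|nvg] := pselect (vanishing g).
  have [N gN] := vanishing_numeral vg.
  have [f [fC [A fA] [B fB]]] :=
    vanishing_numeral_surj (unzigzag (k + zigzag (numeral g N))%R) vg.
  exists f; split => //; exists (maxn A (maxn B N)) => n.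
  rewrite !geq_max => /and3P[An Bn Nn]; split; first exact: fA.
  rewrite /position; have [-> _] := eq_tail_asbool fA; rewrite asboolT //.
  by rewrite fB // gN // unzigzagK addrK.
have [vg|nvg'] := pselect (vanishing (flip_all g)).
  have [N gN] := vanishing_numeral vg.
  have [f [fC [A fA] [B fB]]] :=
    vanishing_numeral_surj (unzigzag (k + zigzag (numeral (flip_all g) N))%R) vg.
  have ffK : flip_all (flip_all f) = f by apply/funext => n; rewrite /flip_all negbK.
  have ffg n : f n = flip_all g n -> flip_all f n = g n.
    by rewrite /flip_all => ->; rewrite negbK.
  exists (flip_all f); split=> [n Cn|]; first by apply/ffg/fC.
  exists (maxn A (maxn B N)) => n.
  rewrite !geq_max => /and3P[An Bn Nn]; split; first exact/ffg/fA.
  rewrite /position; have [|-> ->] := @eq_tail_asbool (flip_all f) g A.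
    by move=> m Am; apply/ffg/fA.
  by rewrite asboolF // asboolT // ffK fB // gN // unzigzagK addrK.
have [A Ak] := nonvanishing_numeral nvg `|k|.
have [B Bk] := nonvanishing_numeral nvg' `|k|.
pose M := maxn A B.
have := leq_trans Ak (numeral_mono g (leq_maxl A B)).
have := leq_trans Bk (numeral_mono (flip_all g) (leq_maxr A B)).
have := numeral_flip_all g M; rewrite -/M => sumM ltB ltA.
have [|f [fa fC ftail]] := @numeral_surj g M (absz ((numeral g M)%:Z + k)%R).
  by lia.
exists f; split => //; exists M => n Mn; split; first exact: ftail.
rewrite /position; have [-> ->] := eq_tail_asbool ftail; rewrite !asboolF //.
by rewrite (numeral_tail ftail Mn) fa; lia.
Qed.

End Odometer.

(** * Labelling the classes of a subrelation by digits *)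

Section DigitLabelling.
Context {d : measure_display} {X : measurableType d}.
Variables (U : int -> X -> X) (V : nat -> X -> Prop).
Hypotheses (U0 : forall x, U 0 x = x)
  (UD : forall (j k : int) x, U (j + k) x = U j (U k x))
  (U_free : forall k x, U k x = x -> k = 0)
  (U_measurable : forall k, measurable_fun setT (U k))
  (V_measurable : forall i, mpred (V i))
  (V_separating : forall x y, x <> y -> exists i, V i x /\ ~ V i y).

Let UK k : cancel (U k) (U (- k)).
Proof. by move=> x; rewrite -UD addNr U0. Qed.

Let UNK k : cancel (U (- k)) (U k).
Proof. by move=> x; rewrite -UD addrN U0. Qed.

Let U_inj j k x : U j x = U k x -> j = k.
Proof.
move=> /(congr1 (U (- k))); rewrite UK -UD => /U_free/eqP.
by rewrite addrC subr_eq0 => /eqP.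
Qed.

Let mU P k : mpred P -> mpred (fun x => P (U k x)).
Proof. exact: mpred_comp. Qed.

Let countable_int : countable [set: int]. Proof. exact: countableP. Qed.
Let countable_nat : countable [set: nat]. Proof. exact: countableP. Qed.

(** One step of halving: a greedy Borel matching in a set Y.  Stage m treats a
  shift k and a set V i, and matches x with U k x if both are still unmatched
  and V i contains x but not U k x.  The last condition makes the sets of left
  and right ends of a stage disjoint. *)
Section Halving.
Variable Y : X -> Prop.

Definition stage (m : nat) : int * nat := odflt (0, 0%N) (unpickle m).
Local Notation shift m := (stage m).1.

Definition left_half_at (A : X -> Prop) m x :=
  [/\ A x, V (stage m).2 x, A (U (shift m) x) & ~ V (stage m).2 (U (shift m) x)].

Fixpoint unmatched (m : nat) : X -> Prop :=
  if m is m'.+1 then fun x =>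
    [/\ unmatched m' x, ~ left_half_at (unmatched m') m' x
      & ~ left_half_at (unmatched m') m' (U (- shift m') x)]
  else Y.

Definition matched_left m := left_half_at (unmatched m) m.
Definition matched_right m x := matched_left m (U (- shift m) x).
Definition half x := exists m, matched_left m x.
Definition leftover x := forall m, unmatched m x.

Lemma matched_unmatched m x :
  matched_left m x \/ matched_right m x -> unmatched m x.
Proof. by case=> -[] //; rewrite UNK. Qed.

Lemma unmatched_le m n x : (m <= n)%N -> unmatched n x -> unmatched m x.
Proof. by move=> /subnK <-; elim: (n - m)%N => //= k IH [/IH]. Qed.

Lemma matched_once m n x : matched_left m x \/ matched_right m x ->
  matched_left n x \/ matched_right n x -> m = n.
Proof.
wlog: m n / (m < n)%N => [hw|mn] mx nx.
  by have [mn|nm|//] := ltngtP m n; [exact: hw|apply/esym/hw].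
have [_ nl nr] := unmatched_le mn (matched_unmatched nx).
by case: mx => [/nl|/nr].
Qed.

Lemma matched_left_right m n x : matched_left m x -> ~ matched_right n x.
Proof.
move=> lx rx; have mn := matched_once (or_introl lx) (or_intror rx).
by move: lx rx; rewrite -mn => -[_ Vx _ _] [_ _ _]; rewrite UNK.
Qed.

Lemma matchedP x : Y x -> ~ leftover x ->
  (exists m, matched_left m x) \/ (exists m, matched_right m x).
Proof.
move=> Yx /existsNP[m]; elim: m => // m IH Nmx.
have [/IH //|/contrapT mx] := pselect (~ unmatched m x).
have [lx|nlx] := pselect (matched_left m x); first by left; exists m.
have [rx|nrx] := pselect (matched_right m x); first by right; exists m.
by case: Nmx; split.
Qed.

(** Two points of one orbit are separated by some V i and would have been
  matched at the stage of their shift and i. *)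
Lemma leftover_unique k x : leftover x -> leftover (U k x) -> k = 0.
Proof.
move=> Lx LUx; apply: contrapT => k0.
have [|i [Vx nVx]] := @V_separating x (U k x); first by move=> /esym/U_free.
have [_ nl _] := Lx (pickle (k, i)).+1; apply: nl.
have st : stage (pickle (k, i)) = (k, i) by rewrite /stage pickleK.
by rewrite /left_half_at st; split => //; [exact: Lx|exact: LUx].
Qed.

Lemma half_sub x : half x -> Y x.
Proof. by case=> m [/(unmatched_le (leq0n m))]. Qed.

(** Folds the right ends onto the left ends.  On matched points this is two to
  one, and half tells the two preimages of a point apart. *)
Definition fold x : X :=
  if pselect (exists m, matched_right m x) is left rx
  then U (- shift (projT1 (cid rx))) x else x.

Lemma fold_right m x : matched_right m x -> fold x = U (- shift m) x.
Proof.
move=> mx; rewrite /fold; case: pselect => [rx|]; last by case; exists m.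
by case: cid => n nx /=; rewrite (matched_once (or_intror mx) (or_intror nx)).
Qed.

Lemma fold_notright x : ~ (exists m, matched_right m x) -> fold x = x.
Proof. by rewrite /fold; case: pselect. Qed.

Lemma fold_left x : half x -> fold x = x.
Proof.
by case=> m lx; apply: fold_notright => -[n]; exact: matched_left_right lx.
Qed.

Lemma fold_orbit x : exists k, fold x = U k x.
Proof.
by rewrite /fold; case: pselect => [rx|_]; [eexists|exists 0; rewrite U0].
Qed.

Lemma fold_half x : Y x -> ~ leftover x -> half (fold x).
Proof.
move=> Yx /(matchedP Yx)[lx|[m rx]]; first by rewrite fold_left.
by rewrite (fold_right rx); exists m.
Qed.

Lemma fold_inj x y : Y x -> Y y -> ~ leftover x -> ~ leftover y ->
  fold x = fold y -> (half x <-> half y) -> x = y.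
Proof.
move=> Yx Yy Lx Ly fxy hxy.
have [hx|nhx] := pselect (half x).
  by rewrite -(fold_left hx) fxy fold_left // -hxy.
have [//|[m mx]] := matchedP Yx Lx.
have [hy|[n ny]] := matchedP Yy Ly; first by case: nhx; rewrite hxy.
move: fxy; rewrite (fold_right mx) (fold_right ny).
have [lm ln] : matched_left m (U (- shift m) x) /\ matched_left n (U (- shift n) y) by [].
move=> exy; rewrite exy in lm.
have := matched_once (or_introl lm) (or_introl ln) => mn.
by move: exy; rewrite mn => /(can_inj (UNK _)).
Qed.

Lemma fold_surj z (b : bool) : half z ->
  exists x, [/\ Y x, fold x = z, ~~ `[<half x>] = b & exists k, x = U k z].
Proof.
move=> hz; case: b; last first.
  exists z; split; [exact: half_sub|exact: fold_left|by rewrite asboolT|].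
  by exists 0; rewrite U0.
case: (hz) => m lz; have rx : matched_right m (U (shift m) z).
  by rewrite /matched_right UK.
exists (U (shift m) z); split; last by exists (shift m).
- exact: (unmatched_le (leq0n m) (matched_unmatched (or_intror rx))).
- by rewrite (fold_right rx) UK.
- by rewrite asboolF // => -[n] /matched_left_right/(_ rx).
Qed.

Hypothesis mY : mpred Y.

Lemma mpred_unmatched m : mpred (unmatched m).
Proof.
elim: m => //= m IH.
have mL : mpred (left_half_at (unmatched m) m).
  apply: (@eq_mpred _ _ (fun x => (unmatched m x /\ V (stage m).2 x) /\
     (unmatched m (U (shift m) x) /\ ~ V (stage m).2 (U (shift m) x)))).
    by move=> x; split=> [[[? ?] [? ?]]|[? ? ? ?]].
  by apply: mpred_and; apply: mpred_and => //; [exact: mU|apply/mpred_not/mU].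
apply: (@eq_mpred _ _ (fun x => unmatched m x /\
   (~ left_half_at (unmatched m) m x /\
    ~ left_half_at (unmatched m) m (U (- shift m) x)))).
  by move=> x; split=> [[? [? ?]]|[? ? ?]].
by apply: mpred_and => //; apply: mpred_and; apply: mpred_not => //; exact: mU.
Qed.

Lemma mpred_matched_left m : mpred (matched_left m).
Proof.
have mu := mpred_unmatched m.
apply: (@eq_mpred _ _ (fun x => (unmatched m x /\ V (stage m).2 x) /\
     (unmatched m (U (shift m) x) /\ ~ V (stage m).2 (U (shift m) x)))).
  by move=> x; split=> [[[? ?] [? ?]]|[? ? ? ?]].
by apply: mpred_and; apply: mpred_and => //; [exact: mU|apply/mpred_not/mU].
Qed.

Lemma mpred_half : mpred half.
Proof. by apply: mpred_ex => // m; exact: mpred_matched_left. Qed.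

Lemma mpred_leftover : mpred leftover.
Proof. by apply: mpred_all => // m; exact: mpred_unmatched. Qed.

Lemma mpred_fold k : mpred (fun x => fold x = U k x).
Proof.
have mr m : mpred (matched_right m) by apply/mU/mpred_matched_left.
apply: (@eq_mpred _ _ (fun x => (exists m, matched_right m x /\ k = - shift m) \/
   (~ (exists m, matched_right m x) /\ k = 0))).
  move=> x; split=> [[[m [rx ->]]|[nrx ->]]|fx].
  - exact: fold_right.
  - by rewrite U0 fold_notright.
  have [[m rx]|nrx] := pselect (exists m, matched_right m x).
    left; exists m; split => //; move: fx; rewrite (fold_right rx).
    by move/U_inj.
  right; split => //; move: fx; rewrite (fold_notright nrx) -{1}[x]U0.
  by move/U_inj.
apply: mpred_or.
  by apply: mpred_ex => // m; apply: mpred_and => //; exact: mpred_const.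
apply: mpred_and; last exact: mpred_const.
by apply/mpred_not/mpred_ex.
Qed.

End Halving.

Definition tower (n : nat) : X -> Prop := iter n half (fun=> True).

Fixpoint rho (n : nat) (x : X) : X :=
  if n is n'.+1 then fold (tower n') (rho n' x) else x.

Definition digit x (n : nat) : bool := ~~ `[<tower n.+1 (rho n x)>].

Definition exceptional x := exists n k, leftover (tower n) (U k x).

Lemma exceptional_shift j x : exceptional (U j x) <-> exceptional x.
Proof.
split=> -[n [k Lx]].
  by exists n, (k + j); rewrite UD.
by exists n, (k - j); rewrite -UD subrK.
Qed.

Lemma rho_orbit n x : exists k, rho n x = U k x.
Proof.
elim: n => [|n [k IH]] /=; first by exists 0; rewrite U0.
by have [j ->] := fold_orbit (tower n) (rho n x); exists (j + k); rewrite UD IH.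
Qed.

Lemma rho_leftover n x : ~ exceptional x -> ~ leftover (tower n) (rho n x).
Proof.
move=> Ex Lx; apply: Ex; have [k rx] := rho_orbit n x.
by exists n, k; rewrite -rx.
Qed.

Lemma rho_tower n x : ~ exceptional x -> tower n (rho n x).
Proof.
move=> Ex; elim: n => //= n IH.
by apply: fold_half => //; exact: rho_leftover.
Qed.

Lemma rho_digit_inj n x y : ~ exceptional x -> ~ exceptional y ->
  rho n x = rho n y -> digit x = digit y -> x = y.
Proof.
move=> Ex Ey + dxy; elim: n => //= n IH rxy; apply: IH.
apply: fold_inj rxy _; try exact: rho_tower; try exact: rho_leftover.
move/(congr1 (@^~ n))/negb_inj: dxy => dxy.
by split=> h; apply/asboolP; [rewrite -dxy|rewrite dxy]; apply/asboolP.
Qed.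

(** From a point of level n down the tower, each digit selects one of the two
  ends of a pair. *)
Lemma rho_digit_surj n z (f : nat -> bool) : ~ exceptional z -> tower n z ->
  exists y, [/\ rho n y = z, forall i, (i < n)%N -> digit y i = f i
    & exists k, y = U k z].
Proof.
elim: n z => [|n IH] z Ez /=; first by exists z; split => //; exists 0; rewrite U0.
move=> /(fold_surj (f n))[x [Yx xz bx [j xE]]].
have [|y [yx df [k yE]]] := IH x _ Yx.
  by rewrite xE => /exceptional_shift.
exists y; split; first by rewrite yx.
- move=> i; rewrite ltnS leq_eqVlt => /orP[/eqP ->|/df //].
  by rewrite /digit yx.
- by exists (k + j); rewrite yE xE UD.
Qed.

Lemma rho_le m n x y : (m <= n)%N -> rho m x = rho m y -> rho n x = rho n y.
Proof. by move=> /subnK <- mxy; elim: (n - m)%N => //= k ->. Qed.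

Lemma mpred_tower n : mpred (tower n).
Proof. by elim: n => [|n]; [exact: mpred_const|exact: mpred_half]. Qed.

Lemma mpred_exceptional : mpred exceptional.
Proof.
apply: mpred_ex => // n; apply: mpred_ex => // k; apply: mU.
exact/mpred_leftover/mpred_tower.
Qed.

Lemma mpred_rho n k : mpred (fun x => rho n x = U k x).
Proof.
elim: n k => [|n IH] k /=.
  apply: (@eq_mpred _ _ (fun=> k = 0)); last exact: mpred_const.
  move=> x; split=> [->|]; first by rewrite U0.
  by rewrite -{1}[x]U0 => /U_inj.
apply: (@eq_mpred _ _ (fun x => exists j, rho n x = U j x /\
   fold (tower n) (U j x) = U (k - j) (U j x))).
  move=> x; split=> [[j [-> ->]]|kx]; first by rewrite -UD subrK.
  by have [j rx] := rho_orbit n x; exists j; rewrite -rx kx rx -UD subrK.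
apply: mpred_ex => // j; apply: mpred_and => //.
apply: (@mU (fun y => fold (tower n) y = U (k - j) y)).
exact/mpred_fold/mpred_tower.
Qed.

(** The base point of an exceptional orbit is the leftover of the first stage
  that has one, and x is at position k if U (- k) x is the base point. *)
Definition base_position x k := exists n,
  leftover (tower n) (U (- k) x) /\
  forall m j, (m < n)%N -> ~ leftover (tower m) (U j x).

Lemma base_position_ex x : exceptional x -> exists k, base_position x k.
Proof.
case=> n; elim/ltn_ind: n => n IH [k Lx].
have [[m [mn [j Lj]]]|first] := pselect (exists m, (m < n)%N /\
  exists j, leftover (tower m) (U j x)).
  by apply: (IH m mn); exists j.
exists (- k), n; rewrite opprK; split => // m j mn Lm; apply: first.
by exists m; split => //; exists j.
Qed.

Lemma base_position_unique x j k :
  base_position x j -> base_position x k -> j = k.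
Proof.
move=> [m [Lm mfirst]] [n [Ln nfirst]].
have mn : m = n.
  have [mn|nm|//] := ltngtP m n.
    by case: (nfirst m (- j) mn).
  by case: (mfirst n (- k) nm).
move: Lm; rewrite mn => Lm; apply/esym/eqP; rewrite -subr_eq0; apply/eqP.
apply: (leftover_unique (Y := tower n) (x := U (- k) x)) => //.
by rewrite -UD addrAC subrr add0r.
Qed.

Lemma base_position_shift x j k :
  base_position x k -> base_position (U j x) (k + j).
Proof.
move=> [n [Ln nfirst]]; exists n; rewrite -UD opprD subrK; split => // m i mn.
by rewrite -UD; exact: nfirst.
Qed.

Lemma mpred_base_position k : mpred (fun x => base_position x k).
Proof.
have mL n j : mpred (fun x => leftover (tower n) (U j x)).
  by apply/mU/mpred_leftover/mpred_tower.
apply: mpred_ex => // n; apply: mpred_and => //.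
apply: mpred_all => // m; apply: mpred_all => // j.
by apply: mpred_imp; [exact: mpred_const|exact: mpred_not].
Qed.

(** The labelling dig maps each sim-class bijectively onto the class of all
  sequences that are eventually equal to a given one. *)
Definition digit_labelling (sim : X -> X -> Prop) (dig : X -> nat -> bool) :=
  [/\ [/\ forall x, sim x x, forall x y, sim x y -> sim y x
        & forall x y z, sim x y -> sim y z -> sim x z],
      forall x y, sim x y -> exists k, y = U k x,
      forall x y, sim x y -> dig x = dig y -> x = y,
      forall x f N, (forall n, (N <= n)%N -> f n = dig x n) ->
        exists2 y, sim x y & dig y = f
    & (forall n, mpred (fun x => dig x n)) /\
      (forall k, mpred (fun x => sim x (U k x)))].

(** On ordinary orbits sim means that the two points fold to the same point of
  some level, and the digits are those of the tower.  On an exceptional orbit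
  sim is the whole orbit, and the point at position k from the base point is
  labelled with the k-th sequence of the class of 0, as counted by the odometer
  on all coordinates. *)
Lemma digit_labelling_ex : exists sim dig, digit_labelling sim dig.
Proof.
have allC N : exists2 n, (N <= n)%N & (fun=> true) n by exists N.
have /boolp.choice[std stdP] : forall k, exists f,
    offset (fun=> true) f (fun=> false) k by move=> k; apply: offset_surj.
have /boolp.choice[pos posP] : forall x, exists k,
    exceptional x -> base_position x k.
  move=> x; have [/base_position_ex[k xk]|nx] := pselect (exceptional x).
    by exists k.
  by exists 0.
have pos_shift x j : exceptional x -> pos (U j x) = pos x + j.
  move=> Ex; apply: (@base_position_unique (U j x)).
    by apply: posP; rewrite exceptional_shift.
  exact/base_position_shift/posP.
pose dig x := if `[<exceptional x>] then std (pos x) else digit x.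
pose sim x y := exists k, y = U k x /\
   (exceptional x \/ exists n, rho n x = rho n y).
exists sim, dig; split.
- split=> [x|x y [k [-> xy]]|x y z [j [-> xy]] [k [-> yz]]].
  + by exists 0; rewrite U0; split => //; right; exists 0%N.
  + exists (- k); rewrite UK exceptional_shift; split => //.
    by case: xy => [|[n rn]]; [left|right; exists n].
  + exists (k + j); rewrite UD; split => //.
    case: xy yz => [|[m rm]]; first by left.
    rewrite exceptional_shift => -[|[n rn]]; first by left.
    right; exists (maxn m n); rewrite (rho_le (leq_maxl m n) rm).
    exact: rho_le (leq_maxr m n) rn.
- by move=> x y [k [-> _]]; exists k.
- move=> x _ [k [-> xy]]; rewrite /dig.
  rewrite (asbool_equiv_eq (exceptional_shift k x)).
  case: asboolP xy => [Ex _|Ex [//|[n rxy]]].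
    rewrite pos_shift // => std_eq.
    have := stdP (pos x + k); rewrite -std_eq => /(offset_functional (stdP _)).
    by move/eqP; rewrite -subr_eq0 opprD addNKr oppr_eq0 => /eqP ->; rewrite U0.
  by move=> dxy; apply: rho_digit_inj rxy dxy => //; rewrite exceptional_shift.
- move=> x f N fx; rewrite /sim.
  have [Ex|Ex] := pselect (exceptional x).
    have fstd n : (N <= n)%N -> f n = std (pos x) n.
      by move=> /fx ->; rewrite /dig asboolT.
    have [//|k fk] := @offset_total (fun=> true) f (std (pos x)) N _ fstd.
    exists (U k x); first by exists k; split => //; left.
    rewrite /dig asboolT; last by rewrite exceptional_shift.
    rewrite pos_shift //; apply/esym/(offset0_eq (C := fun=> true)).
    have := offset_trans fk (offset_trans (stdP (pos x))
      (offset_sym (stdP (pos x + k)))).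
    by rewrite opprD addNKr addrN.
  have [|y [yr yf [k yk]]] := @rho_digit_surj N (rho N x) f _ (rho_tower N Ex).
    by have [j ->] := rho_orbit N x; rewrite exceptional_shift.
  have [j rj] := rho_orbit N x.
  have yE : y = U (k + j) x by rewrite UD -rj.
  exists y; first by exists (k + j); split => //; right; exists N.
  rewrite /dig asboolF; last by rewrite yE exceptional_shift.
  apply/funext => n; have [/yf //|Nn] := ltnP n N.
  by rewrite fx // /dig asboolF // /digit (rho_le Nn yr).
- split=> [n|k].
    apply: (@eq_mpred _ _ (fun x =>
        (exists k, base_position x k /\ (exceptional x /\ std k n)) \/
        (~ exceptional x /\ ~ tower n.+1 (rho n x)))).
      move=> x; rewrite /dig; case: asboolP => Ex; split.
      + by case=> [[k [xk [_]]]|[]//]; rewrite (base_position_unique (posP x Ex) xk).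
      + by left; exists (pos x); split => //; exact: posP.
      + by case=> [[k [_ []]] //|[_ nt]]; rewrite /digit asboolF.
      + by move=> dx; right; split => // tx; move: dx; rewrite /digit asboolT.
    apply: mpred_or; last apply: mpred_and.
    + apply: mpred_ex => // k; apply: mpred_and; first exact: mpred_base_position.
      by apply: mpred_and; [exact: mpred_exceptional|exact: mpred_const].
    + exact/mpred_not/mpred_exceptional.
    + apply: mpred_not; apply: (@eq_mpred _ _ (fun x => exists k,
        rho n x = U k x /\ tower n.+1 (U k x))).
        move=> x; split=> [[k [-> //]]|tx].
        by have [k rk] := rho_orbit n x; exists k; rewrite -rk.
      apply: mpred_ex => // k; apply: mpred_and; first exact: mpred_rho.
      exact/mU/mpred_tower.
apply: (@eq_mpred _ _ (fun x => exceptional x \/ exists n j,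
   rho n x = U j x /\ rho n (U k x) = U (j - k) (U k x))).
  move=> x; split=> [xy|[_ [_ xy]]].
    exists k; split => //; case: xy => [|[n [j [rn rUn]]]]; [by left|right].
    by exists n; rewrite rn rUn -UD subrK.
  case: xy => [|[n rn]]; [by left|right]; exists n.
  have [j rj] := rho_orbit n x; exists j; split => //.
  by rewrite -rn rj -UD subrK.
apply: mpred_or; first exact: mpred_exceptional.
apply: mpred_ex => // n; apply: mpred_ex => // j.
apply: mpred_and; first exact: mpred_rho.
by apply: (@mU (fun y => rho n y = U (j - k) y)); exact: mpred_rho.
Qed.

End DigitLabelling.

(** * A stratification by free Z-actions *)

Section MeasurableOffset.
Context {d : measure_display} {T : measurableType d}.
Implicit Types C f g : T -> nat -> bool.

Let countable_nat : countable [set: nat]. Proof. exact: countableP. Qed.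
Let countable_int : countable [set: int]. Proof. exact: countableP. Qed.
Let countable_bool : countable [set: bool]. Proof. exact: countableP. Qed.

Lemma discrete_valued_bool (b : T -> bool) : mpred b -> discrete_valued b.
Proof.
move=> mb; rewrite (_ : b = (fun p => `[<b p>])).
  exact: discrete_valued_asbool.
by apply/funext => p; rewrite asboolb.
Qed.

Lemma discrete_numeral C f M : (forall n, mpred (fun p => C p n)) ->
  (forall n, mpred (fun p => f p n)) ->
  discrete_valued (fun p => numeral (C p) (f p) M).
Proof.
move=> mC mf.
have mw N : discrete_valued (fun p => weight (C p) N).
  elim: N => [|N IH] /=; first by move=> A; exact: mpred_const.
  apply: (discrete_valued2 (fun c w => if c then 2 * w else w)%N) => //.
  exact: discrete_valued_bool.
elim: M => [|M IH] /=; first by move=> A; exact: mpred_const.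
apply: discrete_valued2 => //.
apply: (discrete_valued2 (fun (b : bool) w => if b then w else 0)%N) => //.
by apply: discrete_valued2 => //; exact: discrete_valued_bool.
Qed.

Lemma mpred_vanishing C f : (forall n, mpred (fun p => C p n)) ->
  (forall n, mpred (fun p => f p n)) ->
  mpred (fun p => vanishing (C p) (f p)).
Proof.
move=> mC mf; apply: mpred_ex => // N; apply: mpred_all => // n.
apply: mpred_imp; first exact: mpred_const.
apply: mpred_imp => //.
exact: (discrete_valued_bool (mf n) [set b | b = false]).
Qed.

Lemma discrete_position C f : (forall n, mpred (fun p => C p n)) ->
  (forall n, mpred (fun p => f p n)) ->
  forall M, discrete_valued (fun p => position (C p) (f p) M).
Proof.
move=> mC mf M.
have mnf n : mpred (fun p => flip_all (f p) n).
  apply: eq_mpred (mpred_not (mf n)) => p; rewrite /flip_all.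
  by split=> /negP.
apply: (discrete_valued2 (fun (b : bool) (ac : nat * int) =>
   if b then zigzag ac.1 else ac.2)
  (f := fun p => `[<vanishing (C p) (f p)>])
  (g := fun p => (numeral (C p) (f p) M,
    if `[<vanishing (C p) (flip_all (f p))>]
    then zigzag (numeral (C p) (flip_all (f p)) M)
    else (numeral (C p) (f p) M)%:Z))) => //.
  by apply: discrete_valued_asbool; exact: mpred_vanishing.
apply: (discrete_valued2 (fun (a : nat) (c : int) => (a, c))) => //.
  exact: discrete_numeral.
apply: (discrete_valued2 (fun (b : bool) (ac : nat * nat) =>
   if b then zigzag ac.1 else ac.2%:Z)
  (f := fun p => `[<vanishing (C p) (flip_all (f p))>])
  (g := fun p => (numeral (C p) (flip_all (f p)) M, numeral (C p) (f p) M))) => //.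
  by apply: discrete_valued_asbool; exact: mpred_vanishing.
by apply: (discrete_valued2 (fun a c : nat => (a, c))) => //; exact: discrete_numeral.
Qed.

Lemma mpred_offset C f g k : (forall n, mpred (fun p => C p n)) ->
  (forall n, mpred (fun p => f p n)) -> (forall n, mpred (fun p => g p n)) ->
  mpred (fun p => offset (C p) (f p) (g p) k).
Proof.
move=> mC mf mg.
have meq n : mpred (fun p => f p n = g p n).
  apply: (@eq_mpred _ _ (fun p => (f p n -> g p n) /\ (g p n -> f p n))).
    by move=> p; split=> [[]|->] //; case: (f p n); case: (g p n) => // a b;
      [have := a isT|have := b isT].
  by apply: mpred_and; exact: mpred_imp.
apply: mpred_and.
  apply: mpred_all => // n; apply: mpred_imp => //.
  by apply: eq_mpred (mpred_not (mC n)) => p; split=> /negP.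
apply: mpred_ex => // N; apply: mpred_all => // n.
apply: mpred_imp; first exact: mpred_const.
apply: mpred_and => //.
exact: (discrete_valued2 (fun a b : int => a - b) countable_int (discrete_position mC mf n)
  (discrete_position mC mg n) [set i | i = k]).
Qed.

End MeasurableOffset.

Section Levels.
Variable R : realType.
Implicit Types r s : R.

(** The coordinate n is labelled with the rational number q of the pair (q, j)
  that n encodes, so every rational number labels infinitely many
  coordinates. *)
Definition level r (n : nat) : bool :=
  if (unpickle n : option (rat * nat)) is Some (q, _) then ratr q < r else false.

Definition coordinate (q : rat) (j : nat) : nat := pickle (q, j).

Lemma level_coordinate r q j : level r (coordinate q j) = (ratr q < r).
Proof. by rewrite /level pickleK. Qed.

Lemma coordinate_inj q : injective (coordinate q).
Proof. by move=> i j /(pcan_inj pickleK)[]. Qed.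

Lemma level_lt r s n : r < s -> level r n -> level s n.
Proof.
by rewrite /level => rs; case: unpickle => // -[q _] /lt_trans; apply.
Qed.

Lemma level_infinite r N : exists2 n, (N <= n)%N & level r n.
Proof.
have /rat_in_itvoo[q] : r - 1 < r by rewrite gtrBl.
rewrite in_itv /= => /andP[_ qr].
apply: contrapT => small.
have lt j : (coordinate q j < N)%N.
  rewrite ltnNge; apply/negP => Nj; apply: small.
  by exists (coordinate q j); rewrite ?level_coordinate.
pose h (j : 'I_N.+1) : 'I_N := Ordinal (lt j).
have /leq_card : injective h by move=> i j /(congr1 val)/coordinate_inj/val_inj.
by rewrite !card_ord ltnn.
Qed.

Lemma level_gap r s : r < s -> exists q : rat, forall j,
  ~~ level r (coordinate q j) /\ level s (coordinate q j).
Proof.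
move=> rs; have [q q_in] := rat_in_itvoo rs.
have /andP[rq qs] : (r < ratr q) && (ratr q < s) by move: q_in; rewrite in_itv.
by exists q => j; rewrite !level_coordinate qs -leNgt ltW.
Qed.

End Levels.

Section StratifiedIntegerActions.
Context {R : realType} {d : measure_display} {X : measurableType d}.
Variables (U : int -> X -> X) (sim : X -> X -> Prop) (dig : X -> nat -> bool).
Hypotheses (U0 : forall x, U 0 x = x)
  (UD : forall (j k : int) x, U (j + k) x = U j (U k x))
  (U_free : forall k x, U k x = x -> k = 0)
  (U_measurable : forall k, measurable_fun setT (U k))
  (labelling : digit_labelling U sim dig).
Implicit Types (r s : R) (x y z : X).

Let simxx x : sim x x. Proof. by have [[h _ _] _ _ _ _] := labelling. Qed.
Let sim_sym x y : sim x y -> sim y x.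
Proof. by have [[_ h _] _ _ _ _] := labelling; exact: h. Qed.
Let sim_trans x y z : sim x y -> sim y z -> sim x z.
Proof. by have [[_ _ h] _ _ _ _] := labelling; exact: h. Qed.
Let sim_orbit x y : sim x y -> exists k, y = U k x.
Proof. by have [_ h _ _ _] := labelling; exact: h. Qed.
Let dig_inj x y : sim x y -> dig x = dig y -> x = y.
Proof. by have [_ _ h _ _] := labelling; exact: h. Qed.
Let dig_surj x f N : (forall n, (N <= n)%N -> f n = dig x n) ->
  exists2 y, sim x y & dig y = f.
Proof. by have [_ _ _ h _] := labelling; exact: h. Qed.
Let mdig n : mpred (fun x => dig x n).
Proof. by have [_ _ _ _ [h _]] := labelling. Qed.
Let msim k : mpred (fun x => sim x (U k x)).
Proof. by have [_ _ _ _ [_ h]] := labelling. Qed.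
Let U_inj j k x : U j x = U k x -> j = k.
Proof.
move=> /(congr1 (U (- k))); rewrite -!UD addNr U0 => /U_free/eqP.
by rewrite addrC subr_eq0 => /eqP.
Qed.

Lemma zact_ex r k x : exists y, sim x y /\ offset (level r) (dig y) (dig x) k.
Proof.
have [f fk] := offset_surj (level_infinite r) (dig x) k.
have [_ [N fN]] := fk.
have [|y xy yf] := @dig_surj x f N; first by move=> n /fN[].
by exists y; rewrite yf.
Qed.

Definition zact r k x : X := projT1 (cid (zact_ex r k x)).

(** The values of the cocycle offset determine the points of a class, which
  makes each class a torsor under Z. *)
Lemma zactP r k x y :
  zact r k x = y <-> sim x y /\ offset (level r) (dig y) (dig x) k.
Proof.
rewrite /zact; case: cid => z [xz zk] /=; split=> [<- //|[xy yk]].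
have zy := sim_trans (sim_sym xz) xy; apply: dig_inj => //.
apply: (offset0_eq (C := level r)); rewrite -(addrN k).
exact: offset_trans zk (offset_sym yk).
Qed.

Lemma zact0 r x : zact r 0 x = x.
Proof. by apply/zactP; split => //; exact: offset_refl. Qed.

Lemma zactD r j k x : zact r (j + k) x = zact r j (zact r k x).
Proof.
have /zactP[xy yk] := erefl (zact r k x).
have /zactP[yz zj] := erefl (zact r j (zact r k x)).
by apply/zactP; split; [exact: sim_trans yz|exact: offset_trans zj yk].
Qed.

Lemma zact_free r k x : zact r k x = x -> k = 0.
Proof.
by move/zactP => [_ xk]; apply: offset_functional xk (offset_refl _ _).
Qed.

Lemma zact_sim r k x : sim x (zact r k x).
Proof. by have /zactP[] := erefl (zact r k x). Qed.

Lemma zact_orbit r k x : exists j, zact r k x = U j x.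
Proof. by have /sim_orbit[j] := zact_sim r k x; exists j. Qed.

Lemma zact_digit r k x n : ~~ level r n -> dig (zact r k x) n = dig x n.
Proof. by have /zactP[_ [+ _]] := erefl (zact r k x); apply. Qed.

Lemma zact_reach r x y N : sim x y ->
  (forall n, ~~ level r n -> dig y n = dig x n) ->
  (forall n, (N <= n)%N -> dig y n = dig x n) -> exists k, zact r k x = y.
Proof.
move=> xy lev tail; have [k yk] := offset_total lev tail.
by exists k; apply/zactP.
Qed.

Lemma zact_mono r s k x : r < s -> exists j, zact r k x = zact s j x.
Proof.
move=> rs; have /zactP[xy [lev [N tail]]] := erefl (zact r k x).
have [||j <-] := @zact_reach s x _ N xy; last by exists j.
  by move=> n ns; apply: lev; apply: contra ns; apply: level_lt.
by move=> n /tail[].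
Qed.

(** Joint measurability in the level and the point: both may depend on a
  parameter p of an auxiliary measurable space. *)
Lemma mpred_zact d' (P : measurableType d') (lev : P -> R) (pt : P -> X) k i :
  (forall q : rat, mpred (fun p => ratr q < lev p)) -> measurable_fun setT pt ->
  mpred (fun p => zact (lev p) k (pt p) = U i (pt p)).
Proof.
move=> mlev mpt.
apply: (@eq_mpred _ _ (fun p => sim (pt p) (U i (pt p)) /\
  offset (level (lev p)) (dig (U i (pt p))) (dig (pt p)) k)).
  by move=> p; rewrite zactP.
apply: mpred_and; first exact: (mpred_comp (P := fun x => sim x (U i x)) mpt).
have mUpt : measurable_fun setT (fun p => U i (pt p)).
  exact: measurableT_comp.
apply: mpred_offset => n.
- rewrite /level; case: unpickle => [[q _]|]; [exact: mlev|exact: mpred_const].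
- exact: (mpred_comp (P := fun x => dig x n) mUpt).
- exact: (mpred_comp (P := fun x => dig x n) mpt).
Qed.

Definition flip_at (f : nat -> bool) (m : nat) : nat -> bool :=
  fun n => if n == m then ~~ f n else f n.

Lemma flip_ex m x : exists y, sim x y /\ dig y = flip_at (dig x) m.
Proof.
have [|y xy yf] := @dig_surj x (flip_at (dig x) m) m.+1; last by exists y.
by move=> n mn; rewrite /flip_at gtn_eqF.
Qed.

Definition flip m x : X := projT1 (cid (flip_ex m x)).

Lemma flipP m x y : flip m x = y <-> sim x y /\ dig y = flip_at (dig x) m.
Proof.
rewrite /flip; case: cid => z [xz zf] /=; split=> [<- //|[xy yf]].
by apply: dig_inj; [exact: sim_trans (sim_sym xz) xy|rewrite zf yf].
Qed.

Lemma flipK m : involutive (flip m).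
Proof.
move=> x; have /flipP[xy yf] := erefl (flip m x).
apply/flipP; split; first exact: sim_sym.
by rewrite yf; apply/funext => n; rewrite /flip_at; case: eqP; rewrite ?negbK.
Qed.

Lemma flip_orbit m x : exists k, flip m x = U k x.
Proof. by have /flipP[/sim_orbit[k xk] _] := erefl (flip m x); exists k. Qed.

Lemma mpred_flip m i : mpred (fun x => flip m x = U i x).
Proof.
apply: (@eq_mpred _ _ (fun x => sim x (U i x) /\
   forall n, (dig (U i x) n -> flip_at (dig x) m n) /\
     (flip_at (dig x) m n -> dig (U i x) n))).
  move=> x; rewrite flipP; split=> -[xy dxy]; split => //; last by rewrite dxy.
  by apply/funext => n; have [a b] := dxy n; apply/idP/idP.
apply: mpred_and => //; apply: mpred_all => [|n]; first exact: countableP.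
have mf : mpred (fun x => flip_at (dig x) m n).
  rewrite /flip_at; case: eqP => // _.
  by apply: eq_mpred (mpred_not (mdig n)) => x; split=> /negP.
have mg : mpred (fun x => dig (U i x) n).
  exact: (mpred_comp (P := fun x => dig x n) (U_measurable i)).
by apply: mpred_and; exact: mpred_imp.
Qed.

Lemma zact_flip2 s l m x : level s l -> level s m ->
  exists k, zact s k x = flip m (flip l x).
Proof.
move=> sl sm; have /flipP[xy yf] := erefl (flip l x).
have /flipP[yz zf] := erefl (flip m (flip l x)).
apply: (@zact_reach s _ _ (maxn l m).+1); first exact: sim_trans yz.
  move=> n ns; rewrite zf yf /flip_at; case: eqP => [nm|_]; first by rewrite nm sm in ns.
  by case: eqP => [nl|//]; rewrite nl sl in ns.
by move=> n; rewrite gtn_max => /andP[ln mn]; rewrite zf yf /flip_at !gtn_eqF.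
Qed.

Lemma flip2_not_zact r l m x k : ~~ level r l -> l != m ->
  zact r k x <> flip m (flip l x).
Proof.
move=> rl lm E; have := zact_digit k x rl; rewrite E.
have /flipP[_ ->] := erefl (flip m (flip l x)).
have /flipP[_ ->] := erefl (flip l x).
by rewrite /flip_at eqxx (negPf lm); case: (dig x l).
Qed.

End StratifiedIntegerActions.

(** * Borel actions and Polish spaces *)

Section Displacements.
Context {d : measure_display} {P : measurableType d}.
Variables (D : groupType) (B : D -> P -> P).
Hypotheses (countableD : countable [set: D]) (actB : group_action B)
  (mB : forall h, measurable_fun setT (B h)).

(** The maps that move every point by an element of the countable group D which
  depends measurably on the point.  They are closed under composition, and a
  Borel map is handled through its displacement, a function with countably many
  values. *)
Definition displaced (T : P -> P) :=
  exists2 c : P -> D, discrete_valued c & forall p, T p = B (c p) p.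

Lemma displaced_translation h : displaced (B h).
Proof. by exists (fun=> h) => // A; exact: mpred_const. Qed.

Lemma displaced_id : displaced id.
Proof.
by exists (fun=> 1%g) => [A|p]; [exact: mpred_const|rewrite actB.1].
Qed.

Lemma displaced_comp S T : displaced S -> displaced T -> displaced (S \o T).
Proof.
move=> [c mc cE] [c' mc' c'E].
exists (fun p => c (B (c' p) p) * c' p)%g => [A|p]; last first.
  by rewrite actB.2 /= -c'E cE.
apply: (mpred_discrete (P := fun h p => A (c (B h p) * h)%g) countableD mc') => h.
exact: (mpred_comp (P := fun q => A (c q * h)%g) (mB h) (mc [set k | A (k * h)%g])).
Qed.

End Displacements.

Section GroupActionPowers.
Variables (G : groupType) (Y : Type) (A : G -> Y -> Y).
Hypothesis actA : group_action A.

Lemma action_inj g : injective (A g).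
Proof.
by move=> x y /(congr1 (A g^-1%g)); rewrite -!actA.2 mulVg !actA.1.
Qed.

Lemma free_action_inj g h x : free_action A -> A g x = A h x -> g = h.
Proof.
move=> freeA /(congr1 (A h^-1%g)); rewrite -!actA.2 mulVg actA.1 => /freeA.
by move/(congr1 (fun z => h * z)%g); rewrite mulgA mulgV mul1g mulg1.
Qed.

Lemma orbit_rel_equivalence : RelationClasses.Equivalence (orbit_rel A).
Proof.
split=> [x|x _ [g <-]|x _ _ [g <-] [h <-]].
- by exists 1%g; exact: actA.1.
- by exists g^-1%g; rewrite -actA.2 mulVg actA.1.
- by exists (h * g)%g; rewrite actA.2.
Qed.

Lemma action_zexp (W : int -> Y -> Y) e :
    (forall y, W 0 y = y) -> (forall j k y, W (j + k) y = W j (W k y)) ->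
    A e =1 W 1 ->
  forall k, A (zexp e k) =1 W k.
Proof.
move=> W0 WD AW k y; elim/int_rec: k => [|n IH|n IH].
- by rewrite actA.1 W0.
- by rewrite intS zexpD WD actA.2 IH -AW /= expg1.
- apply: (@action_inj e); rewrite [RHS]AW -WD -actA.2.
  have -> h : (e * h = zexp e 1 * h)%g by rewrite /= expg1.
  by rewrite -zexpD intS opprD !addrA addrN add0r IH.
Qed.

End GroupActionPowers.

(** With at most one basis element all elements are powers of it. *)
Lemma nonabelian_free_basis (G : groupType) (S : set G) : free_basis S ->
  ~ (forall g h : G, commute g h) -> exists s t, [/\ S s, S t & s != t].
Proof.
move=> freeS nonab; apply: contrapT => few; apply: nonab.
have [e eS] : exists e, forall s, S s -> s = e.
  have [[s Ss]|noS] := pselect (exists s, S s); last first.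
    by exists 1%g => s Ss; case: noS; exists s.
  exists s => t St; apply: contrapT => ts; apply: few; exists t, s.
  by split => //; apply/eqP.
have pow g : exists k, g = zexp e k.
  have [w [[Sw _ <-] _]] := freeS g.
  elim: w Sw => [|l w IH] Sw; first by exists 0.
  have [|k wk] := IH; first by move=> m mw; apply: Sw; rewrite inE mw orbT.
  exists ((if l.2 then -1 else 1) + k); rewrite zexpD /= wk letterE (eS l.1) //.
  by apply: Sw; rewrite mem_head.
move=> g h; have [j ->] := pow g; have [k ->] := pow h.
by rewrite /commute -!zexpD addrC.
Qed.

Lemma borel_preimage (T T' : topologicalType) (f : T -> T') (A : set T') :
  continuous f -> Borel A -> Borel (f @^-1` A).
Proof.
move=> /continuousP cf; rewrite /Borel => BA.
pose Q := [set A : set T' | <<s @open T >> (f @^-1` A)].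
suff : <<s @open T' >> `<=` Q by exact.
apply: smallest_sub; last by move=> O /cf oO; exact: sub_sigma_algebra.
split=> [|O QO|F QF]; rewrite /Q /=.
- by rewrite preimage_set0; exact: sigma_algebra0.
- exact: (sigma_algebraCD QO).
- by rewrite preimage_bigcup; exact: sigma_algebra_bigcup.
Qed.

Lemma continuous_borel_measurable (T T' : ptopologicalType) (f : T -> T') :
  continuous f -> measurable_fun setT (f : borelType T -> borelType T').
Proof. by move=> cf _ A mA; rewrite setTI; exact: borel_preimage. Qed.

(** The balls of radius 1/(n+1) around the points of a countable dense set. *)
Lemma polish_separating (R : realType) (X : topologicalType) : polish R X ->
  exists V : nat -> set X, (forall i, open (V i)) /\
    forall x y, x <> y -> exists i, V i x /\ ~ V i y.
Proof.
move=> [[D /countable_injP[c c_inj] denseD] [dist [d0 dC dD dN _]]].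
have dxx x : dist x x = 0 by apply/d0.
have d_ge0 x y : 0 <= dist x y.
  by have := dD x y x; rewrite dxx (dC y x); lra.
have open_ball x e : open [set y | dist x y < e].
  rewrite openE => y /= xy; apply/dN; exists (e - dist x y); first by rewrite subr_gt0.
  by move=> z /= yz; have := dD x y z; lra.
pose dec i : nat * nat := odflt (0%N, 0%N) (unpickle i).
pose V i := [set y | exists x, [/\ D x, c x = (dec i).1 &
  dist x y < (dec i).2.+1%:R^-1]].
exists V; split=> [i|x y xy].
  have -> : V i = \bigcup_(x in [set x | D x /\ c x = (dec i).1])
      [set y | dist x y < (dec i).2.+1%:R^-1].
    by apply/seteqP; split=> y [x]; [move=> [? ? ?]|move=> [? ?] ?]; exists x.
  by apply: bigcup_open => x _; exact: open_ball.
have xy0 : 0 < dist x y / 2.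
  by rewrite divr_gt0 // lt_neqAle d_ge0 andbT eq_sym; apply/eqP => /d0.
have [n nxy] : exists n : nat, n.+1%:R^-1 < dist x y / 2.
  by exists (Num.truncn (dist x y / 2)^-1);
    rewrite -[ltRHS]invrK ltf_pV2 ?posrE ?invr_gt0 // truncnS_gt.
have [||z [/= xz Dz]] := denseD [set z | dist x z < n.+1%:R^-1].
- by exists x; rewrite /= dxx invr_gt0.
- exact: open_ball.
have st : dec (pickle (c z, n)) = (c z, n) by rewrite /dec pickleK.
exists (pickle (c z, n)); rewrite /V /= st /=; split.
  by exists z; split => //; rewrite dC.
move=> [z' [Dz' czz' zy]]; have zz' : z' = z by apply: c_inj; rewrite ?inE.
rewrite zz' in zy; have := dD x z y.
by move: (n.+1%:R^-1) nxy xz zy => e; lra.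
Qed.

(** * The actions of G *)

(** Infinitely many disjoint sets of equal measure do not fit into a space of
  finite measure. *)
Lemma wandering_null d (T : measurableType d) (R : realType)
    (mu : probability T R) (N : set T) (F : nat -> set T) :
  measurable N -> (forall j, measurable (F j)) -> trivIset setT F ->
  (forall j, mu (F j) = mu N) -> mu N = 0%E.
Proof.
move=> mN mF tF muF.
have finN : mu N \is a fin_num by rewrite fin_num_measure.
have bound n : (fine (mu N) *+ n <= 1).
  have : (mu (\big[setU/set0]_(i < n) F i) <= 1)%E.
    by apply/probability_le1/bigsetU_measurable => i _.
  rewrite measure_bigsetU // (eq_bigr (fun=> (fine (mu N))%:E)) => [|i _].
    by rewrite sumEFin lee_fin sumr_const card_ord.
  by rewrite fineK //; exact: muF.
have : 0 <= fine (mu N) by rewrite fine_ge0.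
rewrite le_eqVlt => /orP[/eqP N0|N0]; first by rewrite -(fineK finN) -N0.
have := bound (Num.truncn (fine (mu N))^-1).+1.
rewrite leNgt -mulr_natr -ltr_pdivrMl // mulr1.
by rewrite truncnS_gt.
Qed.

Section Strata.
Context {R : realType} {d : measure_display} {X : measurableType d}.
Variables (D : groupType) (b : D -> X -> X) (SD : set D) (s t : D).
Hypotheses (countableD : countable [set: D]) (actb : group_action b)
  (freeb : free_action b) (mb : forall h, measurable_fun setT (b h))
  (freeSD : free_basis SD) (SDs : SD s) (SDt : SD t) (neq_st : s != t).

Let U (k : int) (x : X) : X := b (zexp t k) x.

Variables (sim : X -> X -> Prop) (dig : X -> nat -> bool).
Hypothesis labelling : digit_labelling U sim dig.

Variables (G : groupType) (SG : set G) (e0 : G) (iota : G -> nat).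
Hypotheses (freeSG : free_basis SG) (SGe0 : SG e0)
  (iota_inj : injective iota) (iota_e0 : iota e0 = 0%N).

(* All levels are treated at once, as one action on the product of the reals
  with X, so that measurability in the level comes for free. *)
Let P : measurableType _ := (borelType R * X)%type.

Definition lift_action (h : D) (p : P) : P := (p.1, b h p.2).
Local Notation B := lift_action.

Definition generator (e : G) (k : int) (p : P) : P :=
  if e == e0 then (p.1, zact labelling p.1 k p.2)
  else B (conj_power s t (iota e) k) p.

Lemma lift_group_action : group_action B.
Proof.
by split=> [[r x]|g h [r x]]; rewrite /B /= ?actb.1 ?actb.2.
Qed.

Lemma lift_free_action : free_action B.
Proof. by move=> h [r x] [/freeb]. Qed.

Lemma measurable_lift h : measurable_fun setT (B h).
Proof.
apply: measurable_fun_pair; first exact: measurable_fst.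
by apply: measurableT_comp (mb h) _; exact: measurable_snd.
Qed.

Lemma conj_powerD i j k :
  conj_power s t i (j + k) = (conj_power s t i j * conj_power s t i k)%g.
Proof. by rewrite /conj_power zexpD zexpN !mulgA mulgVK. Qed.

Lemma conj_power0 i : conj_power s t i 0 = 1%g.
Proof. by rewrite /conj_power mulg1 zexpN mulgV. Qed.

Lemma generatorD e j k p : generator e (j + k) p = generator e j (generator e k p).
Proof.
rewrite /generator; case: eqP => _ /=; first by rewrite zactD.
by rewrite conj_powerD lift_group_action.2.
Qed.

Lemma generator0 e p : generator e 0 p = p.
Proof.
rewrite /generator; case: eqP => _; first by case: p => r x; rewrite zact0.
by rewrite conj_power0 lift_group_action.1.
Qed.

Lemma generator_level e k p : (generator e k p).1 = p.1.
Proof. by rewrite /generator; case: eqP. Qed.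

Lemma U_zero x : U 0 x = x. Proof. exact: actb.1. Qed.

Lemma U_add (j k : int) x : U (j + k) x = U j (U k x).
Proof. by rewrite /U zexpD actb.2. Qed.

Lemma U_free k x : U k x = x -> k = 0.
Proof.
move=> /freeb tk; apply: contrapT => /eqP k0.
apply: (@syl_value_neq1 D SD [:: (t, k)]) => //; first by rewrite /alternating /= k0.
  by move=> a; rewrite inE => /eqP ->.
by rewrite /= mulg1.
Qed.

Lemma generator_displaced e k : displaced B (generator e k).
Proof.
have [->|e0N] := eqVneq e e0; last first.
  rewrite (_ : generator e k = B (conj_power s t (iota e) k)).
    exact: displaced_translation.
  by apply/funext => p; rewrite /generator (negPf e0N).
have /boolp.choice[c cP] : forall p : P, exists j, zact labelling p.1 k p.2 = U j p.2.
  by move=> p; exact: zact_orbit.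
exists (fun p => zexp t (c p)) => [|p]; last by rewrite /generator eqxx cP.
apply/discrete_valued_comp/discrete_valued_fibers => [|j]; first exact: countableP.
apply: (@eq_mpred _ _ (fun p : P => zact labelling p.1 k p.2 = U j p.2)).
  move=> p; rewrite cP; split=> [cj|-> //].
  apply/eqP; rewrite -subr_eq0; apply/eqP/(@U_free _ (U j p.2)).
  by rewrite -U_add subrK.
apply: mpred_zact; [by move=> i; exact: mb| |exact: measurable_snd].
move=> q; apply: (mpred_comp (P := fun r : borelType R => ratr q < r)).
  exact: measurable_fst.
by apply: sub_sigma_algebra; exact: open_gt.
Qed.

Variable A : G -> P -> P.
Hypotheses (actA : group_action A)
  (A_word : forall w, word_in SG w ->
     A (word_value w) =1 word_act (generator ^~ 1) (generator ^~ (-1)) w).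

Lemma word_act_cons (l : G * bool) w p :
  word_act (generator ^~ 1) (generator ^~ (-1)) (l :: w) p =
  generator l.1 (if l.2 then -1 else 1)
    (word_act (generator ^~ 1) (generator ^~ (-1)) w p).
Proof. by rewrite /=; case: l.2. Qed.

Lemma A_words g : exists2 w, word_in SG w &
  A g =1 word_act (generator ^~ 1) (generator ^~ (-1)) w.
Proof. by have [w [[Sw _ <-] _]] := freeSG g; exists w => //; exact: A_word. Qed.

Lemma A_zexp e k : SG e -> A (zexp e k) =1 generator e k.
Proof.
move=> Se; apply: action_zexp => //; [exact: generator0|exact: generatorD|].
move=> p; have := @A_word [:: (e, false)] _ p.
by rewrite /= mulg1 /letter /=; apply => l; rewrite inE => /eqP ->.
Qed.

Lemma A_level g p : (A g p).1 = p.1.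
Proof.
have [w _ ->] := A_words g.
by elim: w => // l w IH; rewrite word_act_cons generator_level IH.
Qed.

Lemma A_displaced g : displaced B (A g).
Proof.
have [w _ Aw] := A_words g.
rewrite (_ : A g = word_act (generator ^~ 1) (generator ^~ (-1)) w); last exact/funext.
elim: w {Aw} => [|l w IH].
  by apply: displaced_id; exact: lift_group_action.
rewrite (_ : word_act _ _ _ = generator l.1 (if l.2 then -1 else 1) \o
    word_act (generator ^~ 1) (generator ^~ (-1)) w).
  apply: displaced_comp => //; [exact: lift_group_action|exact: measurable_lift|].
  exact: generator_displaced.
by apply/funext => p; rewrite word_act_cons.
Qed.

(** A syllable e^k moves a point by s^i t^k' s^-i with i = iota e and k' nonzero:
  for e = e0 the exponent k' depends on the point and is nonzero because the
  Z-action of e0 is free. *)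
Lemma A_syllables (L : seq (G * int)) p : alternating L ->
  (forall a, a \in L -> SG a.1) ->
  exists L', [/\ alternating L', [seq a.1 | a <- L'] = [seq iota a.1 | a <- L] &
    A (syl_value L) p = B (conj_value s t L') p].
Proof.
elim: L => [|[e k] L IH]; first by exists [::]; rewrite /= actA.1 lift_group_action.1.
rewrite alternating_cons => /= /and3P[k0 headL altL] SL.
have [|L' [altL' fstL' AL']] := IH altL.
  by move=> a aL; apply: SL; rewrite inE aL orbT.
have Se : SG e by apply: (SL (e, k)); rewrite mem_head.
have [k' k'0 gk'] : exists2 k', k' != 0 & generator e k (B (conj_value s t L') p) =
    B (conj_power s t (iota e) k') (B (conj_value s t L') p).
  rewrite /generator; case: eqP => [->|_]; last by exists k.
  have [k' zk'] := zact_orbit labelling p.1 k (b (conj_value s t L') p.2).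
  exists k'; last by rewrite iota_e0 /B /= zk' /conj_power mulg1 mul1g.
  apply: contraNneq k0 => k'0; apply/eqP.
  by move: zk'; rewrite k'0 U_zero => /zact_free.
exists ((iota e, k') :: L'); split.
- rewrite alternating_cons /= k'0 altL' andbT /=.
  case: L' fstL' {AL' altL' gk'} => [|a' L'] //.
  case: L headL {SL altL IH} => // a L ea [-> _].
  by rewrite (inj_eq iota_inj).
- by rewrite /= fstL'.
- by rewrite /= actA.2 AL' A_zexp // gk' lift_group_action.2.
Qed.

Lemma A_free : free_action A.
Proof.
move=> g p; have [L [altL SL <-]] := free_basis_syllables g freeSG.
have [L' [altL' fstL' ->]] := A_syllables p altL SL.
move=> /lift_free_action L'1.
have L'0 : L' = [::].
  apply/eqP/negPn/negP => /(conj_value_neq1 freeSD SDs SDt neq_st altL').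
  exact.
by move: fstL'; rewrite L'0; case: (L).
Qed.

(** Within an orbit of t, the new action is only that of its generator e0. *)
Lemma A_zact g r x m : A g (r, x) = (r, U m x) ->
  exists k, zact labelling r k x = U m x.
Proof.
have [L [altL SL <-]] := free_basis_syllables g freeSG.
have [L' [altL' fstL' AL]] := A_syllables (r, x) altL SL.
rewrite AL => -[BU]; have Ltm := free_action_inj actb freeb BU.
have [L'0|[k L'k]] := conj_value_power freeSD SDs SDt neq_st altL' Ltm.
  exists 0; rewrite zact0; move: Ltm; rewrite L'0 /= => t1.
  by rewrite /U -t1 actb.1.
move: fstL' altL SL AL BU; rewrite L'k.
case: L => [|[e j] [|]] //= [ie] _ SL AL BU; exists j.
have ee0 : e = e0 by apply: iota_inj; rewrite iota_e0.
rewrite -BU; move: AL.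
rewrite (mulg1 (zexp e j)) A_zexp; last by apply: (SL (e, j)); rewrite mem_head.
by rewrite /generator ee0 eqxx => -[].
Qed.

Definition stratum (r : R) (g : G) (x : X) : X := (A g (r, x)).2.

Lemma A_stratum r g x : A g (r, x) = (r, stratum r g x).
Proof. by rewrite /stratum -{2}[r]/((r, x).1) -(A_level g) -surjective_pairing. Qed.

Lemma stratum_action r : group_action (stratum r).
Proof.
split=> [x|g h x]; first by rewrite /stratum actA.1.
by rewrite {1}/stratum actA.2 A_stratum.
Qed.

Lemma stratum_free r : free_action (stratum r).
Proof. by move=> g x gx; apply: (@A_free g (r, x)); rewrite A_stratum gx. Qed.

Lemma stratum_orbit r g x : exists h, stratum r g x = b h x.
Proof.
by have [c _ cE] := A_displaced g; exists (c (r, x)); rewrite /stratum cE.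
Qed.

Lemma zact_stratum r k x : orbit_rel (stratum r) x (zact labelling r k x).
Proof. by exists (zexp e0 k); rewrite /stratum A_zexp // /generator eqxx. Qed.

Lemma stratum_mono r r' : r < r' ->
  subrelation (orbit_rel (stratum r)) (orbit_rel (stratum r')).
Proof.
move=> rr' x _ [g <-]; have [w Sw Aw] := A_words g.
rewrite [stratum r g x]/stratum Aw {Aw g}.
have eqv := orbit_rel_equivalence (stratum_action r').
elim: w Sw => [|l w IH] Sw; first exact: RelationClasses.Equivalence_Reflexive.
have {}IH : _ := IH (fun m mw => Sw m (mem_behead (s := l :: w) mw)).
have lev : (word_act (generator ^~ 1) (generator ^~ (-1)) w (r, x)).1 = r.
  elim: (w) => // m v IHv.
  by rewrite word_act_cons generator_level.
rewrite word_act_cons; set p := word_act _ _ w _ in IH lev *.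
apply: (RelationClasses.Equivalence_Transitive _ _ _ IH).
set k : int := if l.2 then _ else _.
have Sl : SG l.1 by apply: Sw; rewrite mem_head.
rewrite /generator; case: eqP => [_|/eqP le].
  by rewrite /= lev; have [j ->] := zact_mono labelling k p.2 rr'; exact: zact_stratum.
by exists (zexp l.1 k); rewrite /stratum A_zexp // /generator (negPf le).
Qed.

(** Flipping two digits labelled with a rational number q such that r <= q < r'
  keeps the point in its class for r', and leads out of its class for r. *)
Lemma stratum_gap (r r' : R) : r < r' -> exists q : rat, forall i j x, i != j ->
  let y := flip labelling (coordinate q j) (flip labelling (coordinate q i) x) in
  orbit_rel (stratum r') x y /\ ~ orbit_rel (stratum r) x y.
Proof.
move=> /level_gap[q qP]; exists q => i j x ij y; split.
  rewrite /y; have [k <-] := zact_flip2 labelling x (qP i).2 (qP j).2.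
  exact: zact_stratum.
move=> [g gy]; have [m ym] : exists m, y = U m x.
  have [m1 E1] := flip_orbit labelling (coordinate q i) x.
  have [m2 E2] := flip_orbit labelling (coordinate q j) (U m1 x).
  by exists (m2 + m1); rewrite /y E1 E2 U_add.
have [|k] := @A_zact g r x m; first by rewrite A_stratum gy ym.
rewrite -ym; apply: flip2_not_zact; first exact: (qP i).1.
by apply: contra ij => /eqP/coordinate_inj ->.
Qed.

Lemma measurable_flip m : measurable_fun setT (flip labelling m).
Proof.
move=> _ C mC; rewrite setTI.
apply: (@eq_mpred _ _ (fun x => exists k, flip labelling m x = U k x /\ C (U k x))).
  move=> x; split=> [[k [-> //]]|Cx].
  by have [k xk] := flip_orbit labelling m x; exists k; rewrite -xk.
apply: mpred_ex => [|k]; first exact: countableP.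
apply: mpred_and; last exact: (mpred_comp (P := C) (mb _)).
by apply: mpred_flip => j; exact: mb.
Qed.

End Strata.

(** * The stratification *)

Lemma borel_action_measurable (D : groupType) (X : ptopologicalType)
    (b : D -> X -> X) h : borel_action b ->
  measurable_fun setT (b h : borelType X -> borelType X).
Proof.
move=> borelb _ B mB; rewrite setTI.
pose sect (x : X) : (discrete_topology D * X)%type := (h, x).
have csect : continuous sect.
  move=> x C [[P Q] /= [hP xQ] PQ]; apply: (filterS _ xQ) => y Qy.
  by apply: (PQ (h, y)); split => //; exact: nbhs_singleton hP.
exact: (borel_preimage csect (borelb B mB)).
Qed.

(** By countability of D and G the graph is a countable union of sets on which
  the acting element and its displacement h are fixed; there the condition
  b h x = y is expressed by the open sets V i. *)
Lemma borel_family_displaced (R : realType) (X : ptopologicalType)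
    (D G : groupType) (b : D -> borelType X -> borelType X) (V : nat -> set X)
    (A : G -> borelType R * borelType X -> borelType R * borelType X) :
  countable [set: D] -> countable [set: G] ->
  (forall h, measurable_fun setT (b h)) ->
  (forall i, open (V i)) ->
  (forall x y, x <> y -> exists i, V i x /\ ~ V i y) ->
  (forall g, displaced (lift_action b) (A g)) ->
  borel_family (fun r g x => (A g (r, x)).2 : X).
Proof.
move=> cD cG mb openV sepV dispA.
have /boolp.choice[c cP] : forall g, exists c : borelType R * borelType X -> D,
    discrete_valued c /\ forall p, A g p = lift_action b (c p) p.
  by move=> g; have [c mc cE] := dispA g; exists c.
pose Z : topologicalType := (R * ((discrete_topology G * X) * X))%type.
pose z0 : Z := (0, ((1%g, point), point)).
pose Zp : ptopologicalType := HB.pack (R * ((discrete_topology G * X) * X))%type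
  (isPointed.Build (R * ((discrete_topology G * X) * X))%type z0).
have cfst (T T' : topologicalType) : continuous (@fst T T').
  by move=> z; exact: cvg_fst.
have csnd (T T' : topologicalType) : continuous (@snd T T').
  by move=> z; exact: cvg_snd.
have c21 : continuous (fun p : Z => p.2.1).
  by move=> p; exact: (continuous_comp (csnd _ _ p) (cfst _ _ p.2)).
have c211 : continuous (fun p : Z => p.2.1.1).
  by move=> p; exact: (continuous_comp (c21 p) (cfst _ _ p.2.1)).
have c212 : continuous (fun p : Z => p.2.1.2).
  by move=> p; exact: (continuous_comp (c21 p) (csnd _ _ p.2.1)).
have c22 : continuous (fun p : Z => p.2.2).
  by move=> p; exact: (continuous_comp (csnd _ _ p) (csnd _ _ p.2)).
have m1 : measurable_fun setT (fun p : borelType Zp => p.1 : borelType R).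
  exact: (@continuous_borel_measurable Zp R _ (cfst _ _)).
have mx : measurable_fun setT (fun p : borelType Zp => p.2.1.2 : borelType X).
  exact: (@continuous_borel_measurable Zp X _ c212).
have my : measurable_fun setT (fun p : borelType Zp => p.2.2 : borelType X).
  exact: (@continuous_borel_measurable Zp X _ c22).
have mV i : @mpred _ (borelType X) (V i).
  by apply: sub_sigma_algebra; exact: openV.
suff : @mpred _ (borelType Zp) (fun p => (A p.2.1.1 (p.1, p.2.1.2)).2 = p.2.2 :> X).
  by [].
apply: (@eq_mpred _ (borelType Zp) (fun p => exists g h, p.2.1.1 = g /\
   (c g (p.1, p.2.1.2) = h /\ forall i, V i (b h p.2.1.2) -> V i p.2.2))).
  move=> p; split=> [[_ [_ [<- [<- hy]]]]|py].
    rewrite (cP _).2 /=; apply: contrapT => /sepV[i [Vb]]; apply.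
    exact: hy.
  exists p.2.1.1, (c p.2.1.1 (p.1, p.2.1.2)); split => //; split => // i.
  by rewrite -py (cP _).2.
apply: mpred_ex => // g; apply: mpred_ex => // h.
apply: mpred_and.
  apply: sub_sigma_algebra; apply: (@open_comp Z (discrete_topology G) _ [set g]).
    by move=> p _; exact: c211.
  exact: discrete_open.
apply: mpred_and.
  apply: (mpred_comp (f := fun p : borelType Zp =>
    (p.1, p.2.1.2) : borelType R * borelType X) (P := fun q => c g q = h)).
    exact: measurable_fun_pair.
  exact: ((cP g).1 [set k | k = h]).
apply: mpred_all => [|i]; first exact: countableP.
apply: mpred_imp; last exact: mpred_comp my (mV i).
by apply: mpred_comp (mV i); apply: measurableT_comp (mb h) mx.
Qed.

(** The maps h i lead out of the smaller class everywhere, which gives the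
  stratification.  A point x of B whose two classes agree inside B has no
  h j (h i x) in B; since h i is an involution, the images under the maps h i
  of the set of these points are disjoint, and it is null. *)
Lemma mu_stratification_gaps (R : realType) (X : ptopologicalType)
    (E : X -> X -> Prop) (mu : probability (borelType X) R)
    (F : R -> X -> X -> Prop) :
  invariant_measure E mu ->
  (forall r, RelationClasses.Equivalence (F r)) ->
  (forall r, subrelation (F r) E) ->
  (forall r s, r < s -> subrelation (F r) (F s)) ->
  (forall r s, r < s -> exists h : nat -> X -> X,
    [/\ forall i, involutive (h i),
        forall i, measurable_fun setT (h i : borelType X -> borelType X),
        forall i x, E x (h i x)
      & forall i j x, i != j -> F s x (h j (h i x)) /\ ~ F r x (h j (h i x))]) ->
  mu_stratification mu E F.
Proof.
move=> invE eqvF subF monoF gaps; split.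
  split=> // r s rs x; exists x; have [h [_ _ _ hF]] := gaps r s rs.
  have [sxy nrxy] := hF 0%N 1%N x isT.
  split=> [y /monoF|/(_ _ sxy)//]; exact.
move=> B mB _ r s rs; have [h [hK mh hE hF]] := gaps r s rs.
pose N := [set x : borelType X | B x /\ forall i j, i != j -> ~ B (h j (h i x))].
have mN : @mpred _ (borelType X)
    (fun x => B x /\ forall i j, i != j -> ~ B (h j (h i x))).
  apply: mpred_and => //; apply: mpred_all => [|i]; first exact: countableP.
  apply: mpred_all => [|j]; first exact: countableP.
  apply: mpred_imp; first exact: mpred_const.
  apply: mpred_not; apply: (mpred_comp (P := B)) => //.
  exact: measurableT_comp (mh j) (mh i).
have imhN i : h i @` N = h i @^-1` N.
  apply/seteqP; split=> [_ [x Nx <-]|x Nx]; first by rewrite /preimage /= hK.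
  by exists (h i x); rewrite ?hK.
have muN0 : mu N = 0%E.
  apply: (@wandering_null _ (borelType X) R mu N (fun i => h i @` N)) => // [i|i j _ _|i].
  - by rewrite imhN -[_ @^-1` _]setTI; exact: mh.
  - case=> _ [[x Nx <-] [y Ny hij]]; apply: contrapT => /eqP ij.
    by apply: Nx.2 ij _; rewrite -hij hK; exact: Ny.1.
  - apply/esym/invE => //; exists (h i); split; [exact: hK|exact: hK| |].
    + by move=> C mC; rewrite -[_ @^-1` _]setTI; exact: mh.
    + by move=> C mC; rewrite -[_ @^-1` _]setTI; exact: mh.
exists N; split => //.
  by rewrite /mrestr (_ : N `&` B = N) //; apply/setIidl => x [].
move=> x /= /not_implyP[Bx nox]; split=> // i j ij Bz; apply: nox.
have [sxz nrxz] := hF i j x ij.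
exists x => //; split=> [y [/(monoF _ _ rs) sxy _ By]|sub]; first by split.
by have [] := sub _ (And3 sxz Bx Bz).
Qed.

Theorem proposition2p4 (R : realType) (X : ptopologicalType)
    (E : X -> X -> Prop) (mu : probability (borelType X) R)
    (polishX : polish R X)
    (cberE : countable_borel_equivalence E)
    (invE : invariant_measure E mu)
    (free_subrel : exists (D : groupType) (b : D -> X -> X),
       [/\ countable_nonabelian_free_group D,
           group_action b, free_action b, borel_action b
         & subrelation (orbit_rel b) E])
    (G : groupType) (freeG : countable_nonabelian_free_group G) :
  exists a : R -> G -> X -> X,
    [/\ forall r, group_action (a r),
        forall r, free_action (a r),
        borel_family a
      & mu_stratification mu E (fun r => orbit_rel (a r))].
Proof.
have [D [b [[cD nabD [SD freeSD]] actb freeb borelb subE]]] := free_subrel.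
have [cG nabG [SG freeSG]] := freeG.
have [s [t [SDs SDt neq_st]]] := nonabelian_free_basis freeSD nabD.
have [e0 [_ [SGe0 _ _]]] := nonabelian_free_basis freeSG nabG.
have [c /in2TT c_inj] := countable_injP _ cG.
pose iota e := if e == e0 then 0%N else (c e).+1.
have iota_e0 : iota e0 = 0%N by rewrite /iota eqxx.
have iota_inj : injective iota.
  by move=> e f; rewrite /iota; do 2 case: eqP => [->|_] //; move=> [/c_inj].
pose bX : D -> borelType X -> borelType X := b.
have mb h : measurable_fun setT (bX h) by exact: borel_action_measurable.
have actX : group_action bX := actb.
have freeX : free_action bX := freeb.
have [V [openV sepV]] := polish_separating polishX.
have mV i : @mpred _ (borelType X) (V i).
  by apply: sub_sigma_algebra; exact: openV.
have [sim [dig labelling]] := digit_labelling_ex (X := borelType X)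
  (U_zero t actX) (U_add t actX)
  (U_free freeX freeSD SDt) (fun k => mb (zexp t k)) mV sepV.
pose gen : G -> int -> borelType R * borelType X -> borelType R * borelType X :=
  generator s labelling e0 iota.
have genK e k : cancel (gen e k) (gen e (- k)).
  by move=> p; rewrite /gen -generatorD // addNr generator0.
have [A [actA A_word]] := free_basis_extension freeSG (genK ^~ 1) (genK ^~ (-1)).
have strat_action r := stratum_action freeSG actA A_word r.
exists (stratum A : R -> G -> X -> X); split => //.
- move=> r; exact: (stratum_free actX freeX freeSD SDs SDt neq_st freeSG
    iota_inj iota_e0 actA A_word).
- apply: (borel_family_displaced cD cG mb openV sepV) => g.
  exact: (A_displaced cD actX freeX mb freeSD SDt freeSG A_word).
apply: mu_stratification_gaps => // [r|r x _ [g <-]|r r' rr'|r r' rr'].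
- exact/orbit_rel_equivalence/strat_action.
- have [h ->] := stratum_orbit cD actX freeX mb freeSD SDt freeSG A_word r g x.
  by apply: subE; exists h.
- exact: (stratum_mono actX freeSG SGe0 actA A_word rr').
have [q qP] := stratum_gap actX freeX freeSD SDs SDt neq_st freeSG SGe0 iota_inj
  iota_e0 actA A_word rr'.
exists (fun i => flip labelling (coordinate q i)); split=> [i|i|i x|i j x ij].
- exact: (flipK labelling).
- exact: (measurable_flip mb labelling).
- have [k ->] := flip_orbit labelling (coordinate q i) x.
  by apply: subE; exists (zexp t k).
- exact: qP.
Qed.
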